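(* For a pair $\mathcal F=(F_1,F_2)$ of finite sets of nonnegative integers (and parameters $\alpha,\beta$), the invariance $$\mathtt{P}_{\mathcal F,x}^{\alpha,\beta}=\mathtt{P}_{I(\mathcal F),x}^{-\alpha-\max F_1-\max F_2-2,\;-\beta-\max F_1+\max F_2}$$ holds.
   Context: The Jacobi polynomials (standard normalization) are $$P_n^{\alpha,\beta}(x)=\frac1{n!}\sum_{j=0}^n\binom{n}{j}(n+\alpha+\beta+1)_j(\alpha+j+1)_{n-j}\left(\frac{x-1}{2}\right)^j,\qquad n\ge0,$$ where $(y)_n=y(y+1)\cdots(y+n-1)$ and $(y)_0=1$. Let $\mathcal F=(F_1,F_2)$ be a pair of finite sets of nonnegative integers, where $F_i$ has $k_i$ elements, and put $k=k_1+k_2$. Define the quasi Wronskian $$U_{\mathcal F,x}^{\alpha,\beta}=\frac{\det A}{(1+x)^{k_2(k_2-1)}},$$ where $A$ is the $k\times k$ matrix whose first $k_1$ rows are indexed by $f\in F_1$ (in increasing order), with entries $(-1)^{j-1}(P_f^{\alpha,\beta})^{(j-1)}(x)$ (where $^{(j-1)}$ is the $(j-1)$-th derivative), $1\le j\le k$, and whose last $k_2$ rows are indexed by $f\in F_2$ (in increasing order), with entries $(\beta-f)_{j-1}(1+x)^{k-j}P_f^{\alpha+j-1,-\beta-j+1}(x)$, $1\le j\le k$. $U_{\mathcal F,x}^{\alpha,\beta}$ is a polynomial in $x$. Let $u_{\mathcal F}^{\alpha,\beta}$ be its leading coefficient, and define the normalized quasi Wronskian $$\mathtt{P}_{\mathcal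 F,x}^{\alpha,\beta}=\frac{U_{\mathcal F,x}^{\alpha,\beta}}{u_{\mathcal F}^{\alpha,\beta}}.$$ For $I(\mathcal F)$, the numbers $k_1,k_2,k$ are those of the pair $I(\mathcal F)$. For a finite set $F$ of nonnegative integers, $I(F)=\{0,1,\dots,\max F\}\setminus\{\max F-f:f\in F\}$, and $I(\mathcal F)=(I(F_1),I(F_2))$. Conventions: the determinant of an empty matrix is $1$; $\max\emptyset=-1$, so that $I(\emptyset)=\emptyset$. *)

(* Defs.v *)
From mathcomp Require Import all_boot all_order all_algebra.
From mathcomp Require Import finmap.

Set Implicit Arguments.
Unset Strict Implicit.
Unset Printing Implicit Defensive.

Import Order.TTheory GRing.Theory Num.Theory.

Local Open Scope fset_scope.
Local Open Scope ring_scope.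

(* Largest element, with the convention that the maximum of the empty set     *)
(* is -1 (hence the values in int).                                           *)
Definition fset_max (F : {fset nat}) : int :=
  if F == fset0 then -1 else (\max_(f <- F) f)%N%:Z.

(* The truncated subtraction [m - f] is exact, since f <= m for f in F.       *)
Definition invol (F : {fset nat}) : {fset nat} :=
  if F == fset0 then fset0 else
  let m := (\max_(f <- F) f)%N in
  [fset i in iota 0 m.+1] `\` [fset (m - f)%N | f in F].

Definition invol_pair (F : {fset nat} * {fset nat}) :
  {fset nat} * {fset nat} := (invol F.1, invol F.2).

Definition pochhammer (R : numFieldType) (y : R) (n : nat) : R :=
  \prod_(i < n) (y + i%:R).

Definition jacobi (R : numFieldType) (n : nat) (a b : R) : {poly R} :=
  (n`!%:R)^-1 *:
  \sum_(j < n.+1)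
    ('C(n, j)%:R * pochhammer (n%:R + a + b + 1) j
       * pochhammer (a + j%:R + 1) (n - j))
    *: (2^-1 *: ('X - 1)) ^+ j.

Definition fset_nth (F : {fset nat}) (i : nat) : nat :=
  nth 0%N (sort leq F) i.

(* Columns are numbered from 0 here: j stands for the usual j - 1.            *)
Definition quasi_wronskian_mx (R : numFieldType)
    (F : {fset nat} * {fset nat}) (a b : R) :
    'M[{poly R}]_(#|` F.1| + #|` F.2|) :=
  let k := (#|` F.1| + #|` F.2|)%N in
  col_mx
    (\matrix_(i < #|` F.1|, j < k)
       ((-1) ^+ j * (jacobi (fset_nth F.1 i) a b)^`(j)))
    (\matrix_(i < #|` F.2|, j < k)
       (pochhammer (b - (fset_nth F.2 i)%:R) j
          *: ((1 + 'X) ^+ (k - 1 - j)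
              * jacobi (fset_nth F.2 i) (a + j%:R) (- b - j%:R)))).

(* The Euclidean quotient is an exact one. The row of f in F.2 is             *)
(* (1 + x)^(k - 1 + b) times the row of the                                   *)
(* (-1)^j (d/dx)^j [(1 + x)^(-b) P_f^(a, -b)(x)]; in the resulting Wronskian  *)
(* k2 of the functions carry a factor (1 + x)^(-b), so it is                  *)
(* (1 + x)^(- k2 b - k1 k2) times a polynomial, and                           *)
(* k2 (k - 1 + b) - k2 b - k1 k2 = k2 (k2 - 1).                               *)
Definition quasi_wronskian (R : numFieldType)
    (F : {fset nat} * {fset nat}) (a b : R) : {poly R} :=
  \det (quasi_wronskian_mx F a b)
    %/ (1 + 'X) ^+ (#|` F.2| * (#|` F.2| - 1)).

(* Meaningful only if the quasi Wronskian is nonzero; it can vanish for       *)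
(* special values of a and b.                                                 *)
Definition normalized_quasi_wronskian (R : numFieldType)
    (F : {fset nat} * {fset nat}) (a b : R) : {poly R} :=
  (lead_coef (quasi_wronskian F a b))^-1 *: quasi_wronskian F a b.

(* Main.v *)
Require Import Defs.
From mathcomp Require Import all_boot all_order all_algebra.
From mathcomp Require Import finmap perm.
From mathcomp Require Import ring zify.

Set Implicit Arguments.
Unset Strict Implicit.
Unset Printing Implicit Defensive.

Import Order.TTheory GRing.Theory Num.Theory.

Local Open Scope fset_scope.
Local Open Scope ring_scope.

(** Put y = 1 + x, let n_i = max F_i + 1, and let N = n_1 + n_2. Up to powers of
    y, the rows of the quasi Wronskian are the derivatives of the functions
    P_f^(a, b), f in F_1, and y^(-b) P_f^(a, -b), f in F_2. Together with the
    functions attached to the missing indices f < n_i they span the solution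
    space of an Euler equation of order N: the span of the powers y^e, where e
    runs over the N nodes m (m < n_1) and m - b (m < n_2). The adjoint equation
    is again an Euler equation, with exponents N - 1 - e; after division by
    y^(n_2) its solution space is the space of the same kind for the parameters
    a' = - a - n_1 - n_2 and b' = - b - n_1 + n_2, which are those of the
    theorem. The Jacobi functions for (a', b'), with each block of indices
    reversed, form the basis dual to the Jacobi functions for (a, b). Hence a
    Wronskian of part of one basis is, up to a constant and a power of y, the
    Wronskian of the complementary part of the dual basis, and reversing the
    complement of F_i in {0, ..., n_i - 1} gives I(F_i).

    Non-integral powers of y never appear in the formal argument, because the
    entries are expanded in powers of y: the determinant is then a minor of a
    product C Y Phi, where C holds the coefficients of the Jacobi polynomials,
    Y is a diagonal matrix of powers of y, and Phi samples polynomials of degree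
    0, 1, 2, ... at the nodes ([quasi_wronskian_mx_reduced]). Two facts make the
    matrices for the two sets of parameters dual to each other. The Jacobi
    equation becomes a two-term recurrence for the coefficients, and the two
    recurrences are adjoint for the weights given by the derivative of the nodal
    polynomial, so that the eigenvalue argument for orthogonality applies
    ([jacobi_coef_orthogonal]). The same weights are those of Lagrange
    interpolation, so that samples of polynomials are orthogonal as long as
    their degrees add up to less than N - 1 ([sum_lagrange_weights]). The
    identity between complementary minors ([dual_minors]) then gives the
    proportionality of the determinants ([det_quasi_wronskian_dual]) whenever
    the eigenvalues and the nodes are distinct and the Jacobi polynomials have
    full degree, which fails only if b, a + b or a - b is an integer from some
    finite range.

    Exceptional parameters are reached by density. Proportionality of two
    polynomials is the vanishing of the cross products of their coefficients;
    along the line (a + 3 t, b + t) these cross products are polynomials in t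
    that vanish where another nonzero polynomial does not, so they vanish at
    t = 0 as well ([poly_fun_dense]). *)

(** Turns an identity that follows from a hypothesis u = v into one that [ring]
    can prove. *)
Lemma eq_of_subr (V : zmodType) (x y u v : V) :
  u = v -> x - y = u - v -> x = y.
Proof. by move=> -> /eqP; rewrite subrr subr_eq0 => /eqP. Qed.

(** * Complementary minors *)

(** Complete P by unit columns that kill all but the lower rows, so that the
    square matrix has determinant \det (usubmx P), and multiply its transpose by
    row_mx Q' Q: the orthogonality of P and Q makes the product block
    triangular. *)
Lemma det_complementary_minor (R : comRingType) (k l : nat)
    (P : 'M[R]_(k + l, k)) (Q : 'M[R]_(k + l, l)) (Q' : 'M[R]_(k + l, k)) :
  P^T *m Q = 0 ->
  \det (usubmx P) * \det (row_mx Q' Q) = \det (P^T *m Q') * \det (dsubmx Q).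
Proof.
move=> PQ0; pose M := row_mx P (col_mx 0 1%:M).
have -> : \det (usubmx P) = \det M^T.
  have -> : M = block_mx (usubmx P) 0 (dsubmx P) 1%:M.
    by rewrite block_mxEh vsubmxK.
  by rewrite det_tr det_lblock det1 mulr1.
rewrite -det_mulmx tr_row_mx mul_col_row PQ0 tr_col_mx trmx0 trmx1.
have selE n (X : 'M[R]_(k + l, n)) : row_mx 0 1%:M *m X = dsubmx X.
  by rewrite -{1}[X]vsubmxK mul_row_col mul0mx mul1mx add0r.
by rewrite !selE det_lblock.
Qed.

Definition diag_pow (R : pzRingType) n (y : R) (e : 'I_n -> nat) : 'M[R]_n :=
  diag_mx (\row_i y ^+ e i).

Lemma det_diag_pow (R : comRingType) n (y : R) (e : 'I_n -> nat) :
  \det (diag_pow y e) = y ^+ (\sum_i e i)%N.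
Proof.
by rewrite det_diag -prodrXr; apply: eq_bigr => i _; rewrite mxE.
Qed.

Lemma det_dsubmx_mul_diag (R : comRingType) k l (d : 'rV[R]_(k + l))
    (M : 'M[R]_(k + l, l)) :
  \det (dsubmx (diag_mx d *m M))
  = (\prod_(i < l) d 0 (rshift k i)) * \det (dsubmx M).
Proof.
have -> : dsubmx (diag_mx d *m M) = diag_mx (rsubmx d) *m dsubmx M.
  by apply/matrixP => i j; rewrite !mul_diag_mx !mxE.
rewrite det_mulmx det_diag; congr (_ * _).
by apply: eq_bigr => i _; rewrite mxE.
Qed.

(** The minors on the first k rows for C and on the last l rows for C' agree
    up to a constant and a power of y. The relation between C and C' says that
    C^T diag(dl)^-1 C' = diag(v)^-1, so both minors come from matrices P and Q
    to which [det_complementary_minor] applies. The powers y^(q i) are there to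
    make the product of the three diagonal matrices the scalar y^T; as q is
    constant on the blocks of C', they commute with C'. *)
Lemma dual_minors (F : fieldType) (k l : nat) (y : {poly F})
    (C C' Phi : 'M[F]_(k + l)) (v dl : 'rV[F]_(k + l))
    (Psi : 'M[F]_(k + l, l)) (Psi' : 'M[F]_(k + l, k))
    (p p' q : 'I_(k + l) -> nat) (T : nat)
    (lift := fun m n => @map_mx _ _ (@polyC F) m n) :
  C *m diag_mx v *m C'^T = diag_mx dl ->
  (forall i, v 0 i != 0) -> (forall i, dl 0 i != 0) ->
  Phi \in unitmx -> row_mx Psi' Psi \in unitmx ->
  (lsubmx Phi)^T *m diag_mx (map_mx GRing.inv v) *m Psi = 0 ->
  (forall i, p i + p' i + q i = T)%N ->
  (forall i j, C' i j != 0 -> q i = q j) ->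
  exists2 c : F, c != 0 &
    y ^+ (\sum_i (q i + p' i))%N
      * \det (usubmx (lift _ _ C *m diag_pow y p *m lift _ _ (lsubmx Phi)))
    = c *: (y ^+ (T * k + \sum_(i < l) q (rshift k i))%N
      * \det (dsubmx (lift _ _ C' *m diag_pow y p' *m lift _ _ Psi))).
Proof.
move=> CvC' v0 dl0 uPhi uPsi orth pT qC.
have diagV (d : 'rV[F]_(k + l)) : (forall i, d 0 i != 0) ->
    diag_mx d *m diag_mx (map_mx GRing.inv d) = 1%:M.
  move=> d0; rewrite mulmx_diag; apply/matrixP => i j; rewrite !mxE.
  have [->|_] := eqVneq i j; last by rewrite !mulr0n.
  by rewrite mulfV.
set W := diag_mx (map_mx GRing.inv v) in orth.
set D := diag_mx (map_mx GRing.inv dl).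
(* A one-sided inverse of a square matrix is two-sided. *)
have CDC' : C^T *m D *m C' = W.
  have inv1 : (diag_mx v *m C'^T *m D) *m C = 1%:M.
    by apply: mulmx1C; rewrite !mulmxA CvC' diagV.
  have inv2 : C^T *m D *m C' *m diag_mx v = 1%:M.
    have := congr1 trmx inv1.
    by rewrite !trmx_mul !tr_diag_mx trmx1 trmxK !mulmxA.
  by rewrite -[LHS]mulmx1 -(diagV v v0) mulmxA inv2 mul1mx.
have uC' : \det C' != 0.
  have : \det (diag_mx dl) != 0 by rewrite det_diag; apply/prodf_neq0.
  by rewrite -CvC' !det_mulmx det_tr mulf_eq0 negb_or => /andP[].
have uD : \det D != 0.
  by rewrite det_diag; apply/prodf_neq0 => i _; rewrite mxE invr_eq0.
have uW : \det W != 0.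
  by rewrite det_diag; apply/prodf_neq0 => i _; rewrite mxE invr_eq0.
have liftM m n o (A : 'M[F]_(m, n)) (B : 'M[F]_(n, o)) :
  lift _ _ (A *m B) = lift _ _ A *m lift _ _ B by exact: map_mxM.
have det_lift n (A : 'M[F]_n) : \det (lift _ _ A) = (\det A)%:P.
  by rewrite det_map_mx.
pose P := lift _ _ C *m diag_pow y p *m lift _ _ (lsubmx Phi).
pose Q n (X : 'M[F]_(k + l, n)) := lift _ _ D *m diag_pow y q
   *m (lift _ _ C' *m diag_pow y p' *m lift _ _ X).
have qcomm : diag_pow y q *m lift _ _ C' = lift _ _ C' *m diag_pow y q.
  apply/matrixP => i j; rewrite mul_diag_mx mul_mx_diag !mxE mulrC.
  by have [->|/qC->//] := eqVneq (C' i j) 0; rewrite polyC0 !mul0r.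
have ppq (M : 'M[{poly F}]_(k + l)) : is_diag_mx M ->
   diag_pow y p *m M *m (diag_pow y q *m diag_pow y p') = y ^+ T *: M.
  case/diag_mxP => d ->; rewrite !mulmx_diag -linearZ /=; congr diag_mx.
  by apply/rowP => i; rewrite !mxE -(pT i) !exprD; ring.
have PQ n (X : 'M[F]_(k + l, n)) :
    P^T *m Q n X = y ^+ T *: lift _ _ ((lsubmx Phi)^T *m W *m X).
  have -> : P^T = lift _ _ (lsubmx Phi)^T *m diag_pow y p *m lift _ _ C^T.
    by rewrite /P !trmx_mul tr_diag_mx /lift !map_trmx mulmxA.
  have dW : is_diag_mx (lift _ _ W).
    by apply/is_diag_mxP => i j ij; rewrite !mxE -val_eqE (negPf ij) mulr0n polyC0.
  transitivity (lift _ _ (lsubmx Phi)^T *m (diag_pow y p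
     *m lift _ _ W *m (diag_pow y q *m diag_pow y p')) *m lift _ _ X).
    rewrite /Q -CDC' !liftM !mulmxA.
    rewrite -[_ *m lift _ _ C' *m diag_pow y q]mulmxA -qcomm !mulmxA.
    do ![congr (_ *m _)].
  by rewrite ppq // -scalemxAr -scalemxAl !liftM.
pose cW := \det ((lsubmx Phi)^T *m W *m Psi').
(* The corner of a block triangular matrix that is invertible as a product. *)
have cW0 : cW != 0.
  have : \det (Phi^T *m W *m row_mx Psi' Psi) != 0.
    by rewrite !det_mulmx det_tr !mulf_neq0 // -unitfE -unitmxE.
  rewrite -{1}[Phi]hsubmxK tr_row_mx mul_col_mx mul_col_row orth.
  by rewrite det_lblock mulf_eq0 negb_or => /andP[].
have QQ' : row_mx (Q _ Psi') (Q _ Psi) = Q _ (row_mx Psi' Psi).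
  by rewrite /Q /lift map_row_mx !mul_mx_row.
have := @det_complementary_minor _ _ _ P (Q _ Psi) (Q _ Psi').
rewrite !PQ orth /lift map_mx0 scaler0 => /(_ erefl).
rewrite detZ -/(lift k k _) det_lift -/cW QQ'.
have -> : \det (Q _ (row_mx Psi' Psi)) =
    (\det D * \det C' * \det (row_mx Psi' Psi))%:P * y ^+ (\sum_i (q i + p' i))%N.
  rewrite /Q !det_mulmx !det_lift !det_diag_pow big_split exprD !polyCM /=; ring.
have -> : \det (dsubmx (Q _ Psi))
    = (\prod_(i < l) (dl 0 (rshift k i))^-1)%:P
      * y ^+ (\sum_(i < l) q (rshift k i))%N
      * \det (dsubmx (lift _ _ C' *m diag_pow y p' *m lift _ _ Psi)).
  rewrite /Q; have -> : lift _ _ D *m diag_pow y q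
      = diag_mx (\row_i ((dl 0 i)^-1%:P * y ^+ q i)).
    rewrite /lift map_diag_mx mulmx_diag; congr diag_mx.
    by apply/rowP => i; rewrite !mxE.
  rewrite det_dsubmx_mul_diag; congr (_ * _).
  rewrite -prodrXr rmorph_prod -big_split; apply: eq_bigr => i _.
  by rewrite mxE.
set c1 := \det D * _ * _; set c2 := \prod_(i < l) _ => E.
have c10 : c1 != 0 by rewrite !mulf_neq0 // -unitfE -unitmxE.
have c20 : c2 != 0.
  by apply/prodf_neq0 => i _; rewrite invr_eq0.
exists (cW * c2 / c1); first by rewrite !mulf_neq0 // invr_eq0.
apply: (@mulfI _ c1%:P); first by rewrite polyC_eq0.
rewrite -[_ *: _]mul_polyC [RHS]mulrA -polyCM mulrC [_ / _]mulrC mulVKf //.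
rewrite -/P [(cW * c2)%:P]polyCM exprD exprM.
by apply: (eq_of_subr E); ring.
Qed.

(** * Lagrange weights *)

Definition nodal (R : comNzRingType) (I : finType) (e : I -> R) : {poly R} :=
  \prod_x ('X - (e x)%:P).

Lemma nodal_deriv (R : comNzRingType) (I : finType) (e : I -> R) x :
  (nodal e)^`().[e x] = (\prod_(z | z != x) ('X - (e z)%:P)).[e x].
Proof.
rewrite /nodal (bigD1 x) //= derivM derivXsubC mul1r !hornerE subrr mul0r.
by rewrite addr0.
Qed.

Lemma nodal_root (R : comNzRingType) (I : finType) (e : I -> R) x :
  (nodal e).[e x] = 0.
Proof. by rewrite /nodal horner_prod (bigD1 x) //= !hornerE subrr mul0r. Qed.

Lemma nodal_deriv_neq0 (R : idomainType) (I : finType) (e : I -> R) x :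
  injective e -> (nodal e)^`().[e x] != 0.
Proof.
move=> inj_e; rewrite nodal_deriv horner_prod; apply/prodf_neq0 => z neq_zx.
by rewrite !hornerE subr_eq0 (inj_eq inj_e) eq_sym.
Qed.

(** The sum is the coefficient of degree #|I| - 1 in the Lagrange interpolant
    of p at the nodes. This interpolant is p itself, whose degree is too small
    for the coefficient to be nonzero. *)
Lemma sum_lagrange_weights (F : fieldType) (I : finType) (e : I -> F)
    (p : {poly F}) : injective e -> (size p < #|I|)%N ->
  \sum_x p.[e x] / (nodal e)^`().[e x] = 0.
Proof.
move=> inj_e szp.
pose l x := \prod_(z | z != x) ('X - (e z)%:P).
have szl x : size (l x) = #|I|.
  have -> : l x = \prod_(z <- enum (predC1 x)) ('X - (e z)%:P) by rewrite big_enum.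
  rewrite size_prod_XsubC -cardE.
  by rewrite (cardC1 x) prednK //; apply/card_gt0P; exists x.
pose r := p - \sum_x (p.[e x] / (nodal e)^`().[e x]) *: l x.
have r0 : r = 0.
  apply: (@roots_geq_poly_eq0 _ r [seq e x | x <- enum I]).
  - apply/allP => _ /mapP[x _ ->]; rewrite rootE /r hornerD hornerN horner_sum.
    rewrite (bigD1 x) //= big1 => [|z neq_zx].
      by rewrite addr0 hornerZ -nodal_deriv divfK ?subrr ?nodal_deriv_neq0.
    rewrite hornerZ /l horner_prod (bigD1 x) 1?eq_sym //=.
    by rewrite !hornerE subrr /= mulr0 mul0r.
  - by rewrite map_inj_uniq ?enum_uniq.
  rewrite size_map -cardE (leq_trans (size_polyD _ _)) // size_polyN geq_max.
  rewrite ltnW //; apply: leq_trans (size_sum _ _ _) _.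
  by apply/bigmax_leqP => x _; rewrite (leq_trans (size_scale_leq _ _)) ?szl.
have := congr1 (fun q : {poly F} => q`_(#|I|.-1)) r0.
rewrite coefB coef0 nth_default; last by case: (#|I|) szp.
rewrite sub0r coef_sum => /eqP; rewrite oppr_eq0 => /eqP sum0.
rewrite -[RHS]sum0.
apply: eq_bigr => x _; rewrite coefZ -(szl x) -lead_coefE.
by rewrite (monicP (monic_prod_XsubC _ _ _)) mulr1.
Qed.

(** A triangular matrix of coefficients times a Vandermonde matrix. *)
Lemma poly_basis_unitmx (F : fieldType) n (e : 'I_n -> F) (psi : nat -> {poly F}) :
  injective e -> (forall j, size (psi j) = j.+1) ->
  \matrix_(i < n, j < n) (psi j).[e i] \in unitmx.
Proof.
move=> inj_e sz.
pose U := \matrix_(j < n, m < n) (psi j)`_m.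
have -> : \matrix_(i, j) (psi j).[e i] = (U *m Vandermonde n (\row_i e i))^T.
  apply/matrixP => i j; rewrite !mxE.
  rewrite (horner_coef_wide _ (n := n)) ?sz //.
  by apply: eq_bigr => m _; rewrite !mxE.
rewrite unitmx_tr unitmx_mul !unitmxE det_Vandermonde !unitfE.
rewrite det_trig; last first.
  by apply/is_trig_mxP => i j ltij; rewrite mxE nth_default ?sz.
apply/andP; split.
  apply/prodf_neq0 => i _; rewrite mxE -[i in _`_i]/(i.+1.-1) -(sz i).
  by rewrite -lead_coefE lead_coef_eq0 -size_poly_eq0 sz.
apply/prodf_neq0 => i _; apply/prodf_neq0 => j ltij.
by rewrite !mxE subr_eq0 (inj_eq inj_e) -val_eqE gtn_eqF.
Qed.

(** The polynomial whose value at x is the Pochhammer symbol (s x + t)_n; the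
    columns of the quasi Wronskian sample it with s = -1, those of the dual one
    with s = 1. *)
Definition rising (R : numFieldType) (s t : R) (n : nat) : {poly R} :=
  \prod_(i < n) (s *: 'X + (t + i%:R)%:P).

Lemma horner_rising (R : numFieldType) (s t x : R) n :
  (rising s t n).[x] = pochhammer (s * x + t) n.
Proof.
rewrite /rising horner_prod; apply: eq_bigr => i _.
by rewrite hornerD hornerZ hornerX hornerC addrA.
Qed.

Lemma size_rising (R : numFieldType) (s t : R) n : s != 0 ->
  size (rising s t n) = n.+1.
Proof.
move=> s0; have sz1 i : size (s *: 'X + (t + i%:R)%:P : {poly R}) = 2%N.
  have szX : size (s *: 'X : {poly R}) = 2%N by rewrite size_scale // size_polyX.
  by rewrite size_polyDl szX // ltnS (leq_trans (size_polyC_leq1 _)).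
rewrite /rising size_prod => [|i _]; last by rewrite -size_poly_eq0 sz1.
rewrite (eq_bigr (fun=> 2%N)) // sum_nat_const card_ord; lia.
Qed.

(** * The nodes of the two blocks *)

(** The exponents of y = 1 + x in the two families of functions: the second
    one carries the factor y^(-b). *)
Definition node (R : numFieldType) n1 n2 (b : R) (x : 'I_n1 + 'I_n2) : R :=
  match x with inl m => m%:R | inr m => m%:R - b end.

(** Both blocks of nodes are arithmetic progressions of step 1, so a shift by
    1 changes only the end factors of each block. *)
Lemma nodal_shift (R : numFieldType) n1 n2 (b : R)
    (N := nodal (@node R n1 n2 b)) :
  (N \Po ('X + 1)) * (('X + (1 - n1%:R)%:P) * ('X + (1 + b - n2%:R)%:P))
  = N * (('X + 1) * ('X + (1 + b)%:P)).
Proof.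
have blockE n (c : R) : (\prod_(i < n) ('X - (i%:R - c)%:P) \Po ('X + 1))
      * ('X + (1 + c - n%:R)%:P)
    = \prod_(i < n) ('X - (i%:R - c)%:P) * ('X + (1 + c)%:P).
  elim: n => [|n IHn]; first by rewrite !big_ord0 comp_polyC subr0.
  rewrite !big_ord_recr /= comp_polyM comp_polyB comp_polyX comp_polyC.
  rewrite [RHS]mulrAC -IHn -[n.+1%:R]natr1 !(polyCD, polyCN); ring.
have -> : N = \prod_(i < n1) ('X - (i%:R - 0)%:P) * \prod_(i < n2) ('X - (i%:R - b)%:P).
  rewrite /N /nodal big_sumType /=; congr (_ * _).
  by apply: eq_bigr => i _; rewrite subr0.
have B1 := blockE n1 0; have B2 := blockE n2 b; rewrite comp_polyM.
move: (\prod_(i < n1) _) (\prod_(i < n2) _) B1 B2 => P1 P2; rewrite !addr0 => B1 B2.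
transitivity ((P1 \Po ('X + 1)) * ('X + (1 - n1%:R)%:P)
   * ((P2 \Po ('X + 1)) * ('X + (1 + b - n2%:R)%:P))); first by ring.
by rewrite B1 B2; ring.
Qed.

(** The derivative of [nodal_shift] at a root t for which t + 1 is a root too.
    It gives the ratio of two consecutive Lagrange weights, which matches the coefficients of the Jacobi recurrence. *)
Lemma nodal_deriv_ratio (R : numFieldType) n1 n2 (b t : R)
    (N := nodal (@node R n1 n2 b)) :
  N.[t] = 0 -> N.[t + 1] = 0 ->
  (t + 1) * (t + 1 + b) * N^`().[t]
  = (t + 1 - n1%:R) * (t + 1 + b - n2%:R) * N^`().[t + 1].
Proof.
move=> Nt Nt1.
have := congr1 (fun p : {poly R} => p^`().[t]) (nodal_shift n1 n2 b).
have dX1 : ('X + 1)^`() = 1 :> {poly R} by rewrite derivD derivX derivC addr0.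
rewrite -/N !derivM deriv_comp dX1 !hornerE horner_comp !hornerE.
rewrite horner_comp !hornerE Nt Nt1 !mul0r !addr0 /= => E.
by apply: (eq_of_subr (esym E)); ring.
Qed.

(** * Jacobi polynomials in powers of 1 + x *)

(** The coefficient of (1 + x)^m. *)
Definition jacobi_coef (R : numFieldType) (n : nat) (a b : R) (m : nat) : R :=
  (jacobi n a b \Po ('X - 1))`_m.

(** The Jacobi polynomial in the variable z = (x - 1) / 2, in which its
    coefficients are explicit. *)
Definition jacobi_series (R : numFieldType) (n : nat) (a b : R) : {poly R} :=
  \poly_(j < n.+1) ((n`!%:R)^-1 * ('C(n, j)%:R
    * pochhammer (n%:R + a + b + 1) j * pochhammer (a + j%:R + 1) (n - j))).

Lemma pochhammer0 (R : numFieldType) (y : R) : pochhammer y 0 = 1.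
Proof. by rewrite /pochhammer big_ord0. Qed.

Lemma pochhammerSr (R : numFieldType) (y : R) n :
  pochhammer y n.+1 = pochhammer y n * (y + n%:R).
Proof. by rewrite /pochhammer big_ord_recr. Qed.

Lemma pochhammerSl (R : numFieldType) (y : R) n :
  pochhammer y n.+1 = y * pochhammer (y + 1) n.
Proof.
rewrite /pochhammer big_ord_recl addr0; congr (_ * _).
by apply: eq_bigr => i _; rewrite /bump /= natrD addrA.
Qed.

Lemma jacobi_comp (R : numFieldType) n (a b : R) (q : {poly R}) :
  jacobi n a b \Po q = jacobi_series n a b \Po (2^-1 *: (q - 1)).
Proof.
rewrite /jacobi_series poly_def !linear_sum /= /jacobi comp_polyZ linear_sum.
rewrite scaler_sumr; apply: eq_bigr => j _.
rewrite /= !comp_polyZ scalerA rmorphXn /= comp_polyZ comp_polyB comp_polyX.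
by rewrite comp_polyC comp_Xn_poly.
Qed.

Lemma jacobi_coef_comp (R : numFieldType) n (a b : R) m :
  jacobi_coef n a b m = (jacobi_series n a b \Po (2^-1 *: 'X - 1))`_m.
Proof.
rewrite /jacobi_coef jacobi_comp; congr (_ \Po _)`_m.
rewrite -addrA -opprD scalerBr; congr (_ - _).
have -> : 1 + 1 = (2%:R : R)%:P by rewrite -polyCD.
by rewrite -mul_polyC -polyCM mulVf ?pnatr_eq0.
Qed.

Lemma jacobi_coef_gt (R : numFieldType) n (a b : R) m : (n < m)%N ->
  jacobi_coef n a b m = 0.
Proof.
move=> ltnm; rewrite jacobi_coef_comp nth_default //.
apply: leq_trans (size_comp_poly_leq _ _) _.
have s2 : (size (2^-1 *: 'X - 1 : {poly R})%R <= 2)%N.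
  rewrite (leq_trans (size_polyD _ _)) // size_polyN size_poly1 geq_max andbT.
  by rewrite (leq_trans (size_scale_leq _ _)) // size_polyX.
have sp : (size (jacobi_series n a b) <= n.+1)%N by exact: size_poly.
rewrite (leq_trans _ ltnm) // ltnS -[leqRHS]muln1.
by apply: leq_mul; rewrite -subn1 leq_subLR.
Qed.

Lemma jacobi_series_rec (R : numFieldType) n (a b : R) j :
  (j.+1%:R * (j%:R + a + 1)) * (jacobi_series n a b)`_j.+1
  = ((n%:R - j%:R) * (n%:R + j%:R + a + b + 1)) * (jacobi_series n a b)`_j.
Proof.
rewrite !coef_poly !ltnS; case: (ltngtP j n) => [ltjn|gtjn|->]; last 2 first.
- by rewrite !mulr0.
- by rewrite subrr mul0r mulr0 mul0r.
rewrite pochhammerSr -(subnSK ltjn) pochhammerSl.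
have -> : a + j.+1%:R + 1 = a + j%:R + 1 + 1 by rewrite -natr1; ring.
have binE : j.+1%:R * 'C(n, j.+1)%:R = (n%:R - j%:R) * 'C(n, j)%:R :> R.
  by rewrite -natrB ?(ltnW ltjn) // -!natrM mul_bin_left.
transitivity ((n`!%:R)^-1 * (j%:R + a + 1) * (j.+1%:R * 'C(n, j.+1)%:R) *
  (pochhammer (n%:R + a + b + 1) j * (n%:R + a + b + 1 + j%:R)) *
   pochhammer (a + j%:R + 1 + 1) (n - j.+1)); first by ring.
rewrite binE; ring.
Qed.

(** The Jacobi equation; 0 and -1 are its finite singular points in the
    variable z. *)
Lemma jacobi_series_ode (R : numFieldType) n (a b : R)
    (p := jacobi_series n a b) :
  'X * ('X + 1) * p^`()^`() + ((a + 1)%:P + (a + b + 2) *: 'X) * p^`()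
  = (n%:R * (n%:R + a + b + 1)) *: p.
Proof.
apply/polyP => j; have := jacobi_series_rec n a b j; rewrite -/p.
have -> : 'X * ('X + 1) * p^`()^`() + ((a + 1)%:P + (a + b + 2) *: 'X) * p^`()
    = 'X * ('X * p^`()^`()) + 'X * p^`()^`() + (a + 1)%:P * p^`()
      + (a + b + 2)%:P * ('X * p^`()) by rewrite -mul_polyC; ring.
rewrite !(coefD, coefXM, coefZ, coefCM, coef_deriv) -!(mulr_natl p`__).
case: j => [|[|j]] /= rec_j.
- apply: (eq_of_subr rec_j); ring.
- apply: (eq_of_subr rec_j); ring.
- apply: (eq_of_subr rec_j); ring.
Qed.

(** The effect of y^(1 - b) d/dx on y^b P_n^(a, b), where
    y = 1 + x = 2 (z + 1). *)
Lemma jacobi_series_shift (R : numFieldType) n (a b : R) :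
  ('X + 1) * (jacobi_series n a b)^`() + b *: jacobi_series n a b
  = (n%:R + b) *: jacobi_series n (a + 1) (b - 1).
Proof.
apply/polyP => j; rewrite mulrDl mul1r.
rewrite !(coefD, coefXM, coefZ, coef_deriv) -!(mulr_natl (jacobi_series n a b)`__).
have -> : (if j == 0%N then 0 else j.-1.+1%:R * (jacobi_series n a b)`_j.-1.+1)
   = j%:R * (jacobi_series n a b)`_j by case: j => [|j] /=; rewrite ?mul0r.
rewrite !coef_poly !ltnS.
have -> : n%:R + (a + 1) + (b - 1) + 1 = n%:R + a + b + 1 by ring.
have -> : a + 1 + j%:R + 1 = a + j%:R + 1 + 1 by ring.
case: (ltngtP j n) => [ltjn|gtjn|->]; last 2 first.
- by rewrite !mulr0 !addr0.
- by rewrite subnn !pochhammer0; ring.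
have binE : j.+1%:R * 'C(n, j.+1)%:R = (n%:R - j%:R) * 'C(n, j)%:R :> R.
  by rewrite -natrB ?(ltnW ltjn) // -!natrM mul_bin_left.
have nE : n%:R = j%:R + 1 + (n - j.+1)%:R :> R by rewrite natr1 -natrD subnKC.
rewrite pochhammerSr -(subnSK ltjn) pochhammerSl pochhammerSr.
have -> : a + j.+1%:R + 1 = a + j%:R + 1 + 1 by rewrite -natr1; ring.
set B := 'C(n, j)%:R in binE *; set B' := 'C(n, j.+1)%:R in binE *.
set s := n%:R + a + b + 1; set P := pochhammer s j.
set Q := pochhammer (a + j%:R + 1 + 1) _; set f := _^-1.
apply: (@eq_of_subr _ _ _ (f * P * (s + j%:R) * Q * (j.+1%:R * B'))
  (f * P * (s + j%:R) * Q * ((n%:R - j%:R) * B))); first by rewrite binE.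
by rewrite /s nE; ring.
Qed.

(** The Jacobi equation read off coefficient by coefficient. The recurrence has
    only two terms because x = -1 is a singular point of the equation. *)
Lemma jacobi_coef_rec (R : numFieldType) n (a b : R) m :
  2 * ((m%:R + 1) * (m%:R + 1 + b)) * jacobi_coef n a b m.+1
  = (m%:R * (m%:R + a + b + 1) - n%:R * (n%:R + a + b + 1))
    * jacobi_coef n a b m.
Proof.
rewrite !jacobi_coef_comp; set g := _ - 1; set p := jacobi_series n a b.
set c := p \Po g.
have dg : g^`() = (2^-1)%:P by rewrite derivB derivZ derivX derivC subr0 alg_polyC.
have dc : c^`() = (2^-1)%:P * (p^`() \Po g) by rewrite deriv_comp dg mulrC.
have ddc : c^`()^`() = (4^-1)%:P * (p^`()^`() \Po g).
  rewrite dc deriv_mulC deriv_comp dg mulrCA -polyCM mulrC.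
  by congr (_%:P * _); rewrite -invfM -natrM.
have X2g : 'X = 2%:P * (g + 1).
  by rewrite subrK mul_polyC scalerA mulfV ?pnatr_eq0 // scale1r.
have p1E : p^`() \Po g = 2%:P * c^`().
  by rewrite dc mulrA -polyCM mulfV ?pnatr_eq0 // mul1r.
have p2E : p^`()^`() \Po g = 4%:P * c^`()^`().
  by rewrite ddc mulrA -polyCM mulfV ?pnatr_eq0 // mul1r.
have ode : 'X * ('X * c^`()^`()) - 2%:P * ('X * c^`()^`())
    + (a + b + 2)%:P * ('X * c^`()) - (2 * (b + 1))%:P * c^`()
    = (n%:R * (n%:R + a + b + 1))%:P * c.
  have := congr1 (fun q => q \Po g) (jacobi_series_ode n a b).
  rewrite -/p !(comp_polyD, comp_polyM, comp_polyZ, comp_polyC, comp_polyX) -/c.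
  rewrite p1E p2E -!mul_polyC => ode; apply: (eq_of_subr ode).
  by rewrite X2g; ring.
have := congr1 (fun q : {poly R} => q`_m) ode.
rewrite !(coefD, coefN, coefXM, coefCM, coef_deriv) -!(mulr_natl c`__).
clear; case: m => [|[|m]] /= ode_m; apply: (eq_of_subr (esym ode_m)); ring.
Qed.

Lemma jacobi_coef_shift (R : numFieldType) n (a b : R) m :
  (m%:R + b) * jacobi_coef n a b m
  = (n%:R + b) * jacobi_coef n (a + 1) (b - 1) m.
Proof.
rewrite !jacobi_coef_comp; set g := _ - 1.
have dg : g^`() = (2^-1)%:P by rewrite derivB derivZ derivX derivC subr0 alg_polyC.
have X2g : 'X = 2%:P * (g + 1).
  by rewrite subrK mul_polyC scalerA mulfV ?pnatr_eq0 // scale1r.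
set p := jacobi_series n a b; set c := p \Po g.
have p1E : p^`() \Po g = 2%:P * c^`().
  by rewrite deriv_comp dg mulrCA -polyCM mulfV ?pnatr_eq0 // mulr1.
have := congr1 (fun q => q \Po g) (jacobi_series_shift n a b).
rewrite !(comp_polyD, comp_polyM, comp_polyZ, comp_polyC, comp_polyX) -/p -/c.
rewrite p1E => shift.
have {}shift : 'X * c^`() + b *: c
    = (n%:R + b) *: (jacobi_series n (a + 1) (b - 1) \Po g).
  by rewrite -shift {1}X2g; ring.
rewrite -[RHS]coefZ -shift coefD coefXM coefZ coef_deriv -(mulr_natl c`__).
by case: m => [|m] /=; ring.
Qed.

Lemma jacobi_coef_lead_neq0 (R : numFieldType) n (a b : R) :
  pochhammer (n%:R + a + b + 1) n != 0 -> jacobi_coef n a b n != 0.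
Proof.
move=> poch_neq0; set p := jacobi_series n a b.
have pn : p`_n != 0.
  rewrite coef_poly ltnSn binn subnn pochhammer0 mulr1 mul1r.
  by rewrite mulf_neq0 // invr_neq0 // pnatr_eq0 -lt0n fact_gt0.
have sp : size p = n.+1.
  apply/eqP; rewrite eqn_leq size_poly /= ltnNge.
  by apply: contra pn => ?; rewrite nth_default.
have sq : size (2^-1 *: 'X - 1 : {poly R}) = 2%N.
  have sX : size (2^-1 *: 'X : {poly R}) = 2%N.
    by rewrite size_scale ?size_polyX // invr_eq0 pnatr_eq0.
  by rewrite size_polyDl sX // size_polyN size_poly1.
have sc := size_comp_poly2 p sq.
rewrite jacobi_coef_comp -[n in _`_n]/(n.+1.-1) -sp -sc -lead_coefE.
by rewrite lead_coef_eq0 -size_poly_eq0 sc sp.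
Qed.

Lemma jacobi_expansion (R : numFieldType) f n (a b : R) : (f < n)%N ->
  jacobi f a b = \sum_(m < n) jacobi_coef f a b m *: (1 + 'X) ^+ m.
Proof.
move=> ltfn.
have {1}-> : jacobi f a b = (jacobi f a b \Po ('X - 1)) \Po (1 + 'X).
  by rewrite -comp_polyA comp_polyB comp_polyX comp_polyC addrC addKr comp_polyXr.
have -> : jacobi f a b \Po ('X - 1) = \poly_(m < n) jacobi_coef f a b m.
  apply/polyP => m; rewrite coef_poly; case: ltnP => // lenm.
  by rewrite -/(jacobi_coef f a b m) jacobi_coef_gt // (leq_trans ltfn).
rewrite poly_def linear_sum /=; apply: eq_bigr => m _.
by rewrite comp_polyZ comp_Xn_poly.
Qed.

(** In powers of y the derivation d/dy followed by multiplication by y is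
    diagonal, so the j-th derivative acts on y^m by a falling factorial. *)
Lemma derivn_expansion (R : numFieldType) j (n : nat) (c : nat -> R)
    (y : {poly R}) : y^`() = 1 ->
  (-1) ^+ j * (\sum_(m < n) c m *: y ^+ m)^`(j) * y ^+ j
  = \sum_(m < n) (c m * pochhammer (- m%:R) j) *: y ^+ m.
Proof.
move=> dy; elim: j => [|j IHj].
  by rewrite mul1r mulr1; apply: eq_bigr => m _; rewrite pochhammer0 mulr1.
rewrite derivnS; set G := _^`(j) in IHj *.
set S := RHS in IHj.
have yS : y * S^`() = \sum_(m < n) (m%:R * (c m * pochhammer (- m%:R) j)) *: y ^+ m.
  rewrite /S linear_sum /= mulr_sumr; apply: eq_bigr => m _.
  rewrite derivZ deriv_exp dy mul1r -scalerAr mulrnAr.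
  case: (m : nat) => [|i] /=; first by rewrite mulr0n mul0r scaler0 scale0r.
  by rewrite -exprS [i.+1%:R * _]mulrC -[RHS]scalerA scaler_nat.
have -> : (-1) ^+ j.+1 * G^`() * y ^+ j.+1 = j%:R *: S - y * S^`().
  have signE : ((-1) ^+ j : {poly R}) = ((-1) ^+ j)%:P.
    by rewrite rmorphXn rmorphN.
  have dS : S^`() = (-1) ^+ j * (G^`() * y ^+ j + G * (y ^+ j.-1 *+ j)).
    rewrite -IHj signE -mulrA deriv_mulC derivM deriv_exp dy mul1r.
    by congr (_ * _).
  have yj : y * (y ^+ j.-1 *+ j) = j%:R * y ^+ j.
    case: (j) => [|i] /=; first by rewrite mulr0n mulr0 mul0r.
    by rewrite mulrnAr -exprS mulr_natl.
  rewrite dS -IHj -mul_polyC polyC_natr !exprS.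
  set s := (-1) ^+ j; set Y := y ^+ j in yj *; set Z := _ *+ _ in yj *.
  by apply: (@eq_of_subr _ _ _ _ _ (congr1 (fun q => s * G * q) yj)); ring.
rewrite yS /S scaler_sumr -sumrB; apply: eq_bigr => m _.
by rewrite scalerA -scalerBl pochhammerSr; congr (_ *: _); ring.
Qed.

(** Iterated [jacobi_coef_shift]: the polynomials P_f^(a + j, -b - j) in the
    columns of the second block are the j-th derivatives of y^(-b) P_f^(a, -b)
    up to a power of y, so their coefficients are those of P_f^(a, -b) times a
    polynomial in the node m - b. *)
Lemma pochhammer_jacobi_coef (R : numFieldType) f (a b : R) j m :
  pochhammer (b - f%:R) j * jacobi_coef f (a + j%:R) (- b - j%:R) m
  = jacobi_coef f a (- b) m * pochhammer (b - m%:R) j.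
Proof.
elim: j => [|j IHj]; first by rewrite !pochhammer0 addr0 subr0 mul1r mulr1.
rewrite !pochhammerSr mulrA -IHj.
have -> : a + j.+1%:R = a + j%:R + 1 by rewrite -natr1 addrA.
have -> : - b - j.+1%:R = - b - j%:R - 1 by rewrite -natr1; ring.
have shift := jacobi_coef_shift f (a + j%:R) (- b - j%:R) m.
set P := pochhammer _ _.
by apply: (@eq_of_subr _ _ _ (P * (_ * _)) _ (congr1 ( *%R P) shift)); ring.
Qed.

(** * Duality of the expansions under the change of parameters *)

(** The usual proof that eigenvectors of an operator and of its adjoint are
    orthogonal if their eigenvalues differ: c is an eigenvector of a bidiagonal
    operator, d one of the transposed operator, and the weights v intertwine
    the two off-diagonals A and B. *)
Lemma bidiagonal_orthogonal (R : comRingType) (n : nat)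
    (c d v mu A B : nat -> R) (l1 l2 : R) :
  c n = 0 -> (mu 0%N - l2) * d 0%N = 0 ->
  (forall m, (m < n)%N -> A m * c m.+1 = (mu m - l1) * c m) ->
  (forall m, (m.+1 < n)%N -> B m * d m = (mu m.+1 - l2) * d m.+1) ->
  (forall m, (m.+1 < n)%N -> A m * v m = B m * v m.+1) ->
  (l1 - l2) * (\sum_(m < n) c m * d m * v m) = 0.
Proof.
move=> cn d0 Hc Hd Hv.
have -> : (l1 - l2) * (\sum_(m < n) c m * d m * v m) =
    \sum_(m < n) (mu m - l2) * d m * (c m * v m)
    - \sum_(m < n) (mu m - l1) * c m * (d m * v m).
  by rewrite mulr_sumr -sumrB; apply: eq_bigr => m _; ring.
have -> : \sum_(m < n) (mu m - l1) * c m * (d m * v m)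
    = \sum_(m < n) A m * c m.+1 * (d m * v m).
  by apply: eq_bigr => m _; rewrite Hc.
case: n cn {Hc} Hd Hv => [|n] cn Hd Hv; first by rewrite !big_ord0 subrr.
rewrite big_ord_recl big_ord_recr /= d0 cn mulr0 !mul0r add0r addr0.
rewrite -sumrB big1 // => m _; rewrite /bump /= add1n -Hd ?ltnS //.
transitivity (c m.+1 * d m * (B m * v m.+1 - A m * v m)); first by ring.
by rewrite Hv ?ltnS // subrr mulr0.
Qed.

(** Reversing the index m exchanges the roles of the two terms of the Jacobi
    recurrence. With a' and b' as given, the reversed recurrence is the adjoint
    one, with the same eigenvalues up to a common constant. Here n is the length
    of the block at hand and n' that of the other one; for the second block, b
    stands for the opposite of the second parameter. *)
Lemma jacobi_coef_orthogonal (R : numFieldType) (n n' : nat) (a b : R)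
    (v : nat -> R) (a' := - a - n%:R - n'%:R) (b' := - b - n%:R + n'%:R) i j :
  (i < n)%N -> (j < n)%N -> i != j ->
  i%:R + j%:R + a + b + 1 != 0 ->
  (forall m, (m.+1 < n)%N -> (m%:R + 1) * (m%:R + 1 + b) * v m
     = (m%:R + 1 - n%:R) * (m%:R + 1 + b - n'%:R) * v m.+1) ->
  \sum_(m < n) jacobi_coef i a b m * jacobi_coef (n.-1 - j) a' b' (n.-1 - m)
     * v m = 0.
Proof.
move=> ltin ltjn neij nes Hv.
pose mu (m : nat) : R := m%:R * (m%:R + a + b + 1).
have : (mu i - mu j) * (\sum_(m < n) jacobi_coef i a b m
    * jacobi_coef (n.-1 - j) a' b' (n.-1 - m) * v m) = 0.
  pose A (m : nat) : R := 2 * ((m%:R + 1) * (m%:R + 1 + b)).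
  pose B (m : nat) : R := 2 * ((m%:R + 1 - n%:R) * (m%:R + 1 + b - n'%:R)).
  pose d m := jacobi_coef (n.-1 - j) a' b' (n.-1 - m).
  have n1E : (n.-1)%:R = n%:R - 1 :> R by case: (n) ltin => // k _; rewrite -natr1 addrK.
  have muE m : (m < n)%N -> (n.-1 - m)%:R * ((n.-1 - m)%:R + a' + b' + 1)
      = mu m - (n%:R - 1) * (n%:R + a + b) :> R.
    move=> ltmn; rewrite natrB; last by case: (n) ltmn.
    by rewrite n1E /mu /a' /b'; ring.
  apply: (bidiagonal_orthogonal (d := d) (mu := mu) (A := A) (B := B)).
  - by rewrite jacobi_coef_gt.
  - have := jacobi_coef_rec (n.-1 - j) a' b' n.-1.
    rewrite jacobi_coef_gt ?mulr0; last by rewrite ltnS leq_subr.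
    have := muE 0%N (leq_ltn_trans (leq0n _) ltin).
    rewrite subn0 => -> ; rewrite muE // /d subn0 => rec0.
    apply: (eq_of_subr (esym rec0)); ring.
  - by move=> m ltmn; rewrite /A jacobi_coef_rec.
  - move=> m ltmn; have ltmn' := ltnW ltmn.
    have := jacobi_coef_rec (n.-1 - j) a' b' (n.-1 - m.+1).
    rewrite !muE // -/(d m.+1).
    have -> : (n.-1 - m.+1).+1 = (n.-1 - m)%N by lia.
    rewrite -/(d m) => recm; apply: (eq_of_subr recm).
    rewrite natrB; last by case: (n) ltmn.
    by rewrite n1E -natr1 /B /b'; ring.
  - by move=> m ltmn; rewrite /A /B -[LHS]mulrA Hv //; exact: mulrA.
have -> : mu i - mu j = (i%:R - j%:R) * (i%:R + j%:R + a + b + 1).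
  by rewrite /mu; ring.
move/eqP; rewrite !mulf_eq0 subr_eq0 eqr_nat (negPf neij) (negPf nes) /=.
by move/eqP.
Qed.

(** The first factor requires m <= i and the second one m >= i. *)
Lemma jacobi_coef_pairing_diag (R : numFieldType) (n : nat) (a b a' b' : R)
    (v : nat -> R) i : (i < n)%N ->
  \sum_(m < n) jacobi_coef i a b m * jacobi_coef (n.-1 - i) a' b' (n.-1 - m)
     * v m
  = jacobi_coef i a b i * jacobi_coef (n.-1 - i) a' b' (n.-1 - i) * v i.
Proof.
move=> ltin; rewrite (bigD1 (Ordinal ltin)) //= big1 ?addr0 // => m.
rewrite -val_eqE /= neq_ltn => /orP[ltmi|ltim].
  rewrite [X in _ * X * _]jacobi_coef_gt ?mulr0 ?mul0r //.
  by have := ltn_ord m; lia.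
by rewrite jacobi_coef_gt // !mul0r.
Qed.

(** * The quasi Wronskian as a minor *)

Definition node_degree n1 n2 (x : 'I_n1 + 'I_n2) : nat :=
  match x with inl m => m | inr m => m end.

Definition node_rev n1 n2 (x : 'I_n1 + 'I_n2) : 'I_n1 + 'I_n2 :=
  match x with inl m => inl (rev_ord m) | inr m => inr (rev_ord m) end.

(** The power of y that completes the degrees of a node and of its reversal to
    n1 + n2 - 1, in both blocks. *)
Definition node_codegree n1 n2 (x : 'I_n1 + 'I_n2) : nat :=
  match x with inl _ => n2 | inr _ => n1 end.

(** The coefficients of the Jacobi polynomials of the two families, as a block
    diagonal matrix. *)
Definition node_coef (R : numFieldType) n1 n2 (a b : R)
    (x z : 'I_n1 + 'I_n2) : R :=
  match x, z with
  | inl f, inl m => jacobi_coef f a b m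
  | inr f, inr m => jacobi_coef f a (- b) m
  | _, _ => 0
  end.

(** The quasi Wronskian matrix cleared of its row and column powers of 1 + x. *)
Definition reduced_mx (R : numFieldType) n1 n2 k (rho : 'I_k -> 'I_n1 + 'I_n2)
    (a b : R) : 'M[{poly R}]_k :=
  \matrix_(i, j) \sum_x (node_coef a b (rho i) x * pochhammer (- node b x) j)
                   *: (1 + 'X) ^+ node_degree x.

Lemma node_revK n1 n2 : involutive (@node_rev n1 n2).
Proof. by case=> m; rewrite /= rev_ordK. Qed.

(** Column j is multiplied by (1 + x)^j, and (1 + x)^(k - 1) is taken out of
    each row of the second block. *)
Lemma quasi_wronskian_mx_reduced (R : numFieldType) (F : {fset nat} * {fset nat})
    n1 n2 (a b : R) (k := (#|` F.1| + #|` F.2|)%N)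
    (r1 : 'I_#|` F.1| -> 'I_n1) (r2 : 'I_#|` F.2| -> 'I_n2)
    (rho : 'I_k -> 'I_n1 + 'I_n2) :
  (forall i, r1 i = fset_nth F.1 i :> nat) ->
  (forall i, r2 i = fset_nth F.2 i :> nat) ->
  (forall i, rho (lshift _ i) = inl (r1 i)) ->
  (forall i, rho (rshift _ i) = inr (r2 i)) ->
  (1 + 'X) ^+ (\sum_(j < k) j)%N * \det (quasi_wronskian_mx F a b)
  = (1 + 'X) ^+ (#|` F.2| * (k - 1))%N * \det (reduced_mx rho a b).
Proof.
move=> r1E r2E rho1 rho2; set y : {poly R} := 1 + 'X.
have dy : y^`() = 1 by rewrite derivD derivX derivC add0r.
pose s (i : 'I_k) := if split i is inl _ then 0%N else (k - 1)%N.
have sl i : s (lshift _ i) = 0%N.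
  by rewrite /s -[lshift _ i]/(unsplit (inl i)) unsplitK.
have sr i : s (rshift _ i) = (k - 1)%N.
  by rewrite /s -[rshift _ i]/(unsplit (inr i)) unsplitK.
have sE : (\sum_i s i = #|` F.2| * (k - 1))%N.
  rewrite big_split_ord /= big1 => [|i _]; last exact: sl.
  rewrite (eq_bigr (fun=> (k - 1)%N)) => [|i _]; last exact: sr.
  by rewrite sum_nat_const card_ord.
rewrite -sE -(det_diag_pow y (fun j : 'I_k => j : nat)) -det_diag_pow.
rewrite mulrC -!det_mulmx; congr (\det _); apply/matrixP => i j.
rewrite mul_mx_diag mul_diag_mx !mxE.
case: (split_ordP i) => i' ->; rewrite ?(sl, sr, mxE, rho1, rho2) big_sumType /=.
- rewrite [X in _ = _ * (_ + X)]big1 ?addr0 => [|m _]; last by rewrite mul0r scale0r.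
  rewrite expr0 mul1r -r1E (jacobi_expansion _ _ (ltn_ord (r1 i'))).
  by rewrite derivn_expansion.
- rewrite [X in _ = _ * (X + _)]big1 ?add0r => [|m _]; last by rewrite mul0r scale0r.
  rewrite -r2E (jacobi_expansion _ _ (ltn_ord (r2 i'))) -/y.
  transitivity (y ^+ (k - 1) * \sum_(m < n2) (pochhammer (b - (r2 i')%:R) j
    * jacobi_coef (r2 i') (a + j%:R) (- b - j%:R) m) *: y ^+ m).
    have kj : (k - 1 - j + j = k - 1)%N.
      by rewrite subnK // subn1 -ltnS (ltn_predK (ltn_ord j)).
    rewrite -[X in _ = y ^+ X * _]kj exprD -[X in X * _ = _]mul_polyC.
    set S := \sum_(m < n2) _; set S' := \sum_(m < n2) _.
    have -> : S' = (pochhammer (b - (r2 i')%:R) j)%:P * S; last by ring.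
    by rewrite mulr_sumr; apply: eq_bigr => m _; rewrite mul_polyC scalerA.
  congr (_ * _); apply: eq_bigr => m _.
  by rewrite pochhammer_jacobi_coef opprB.
Qed.

(** * The duality for generic parameters *)

(** With the dual parameters the exponents are reflected, so that a polynomial
    in the dual nodes is a polynomial of the same degree in the original
    ones. *)
Lemma node_rev_dual (R : numFieldType) n1 n2 (b : R) (x : 'I_n1 + 'I_n2) :
  node (- b - n1%:R + n2%:R) (node_rev x) = n1%:R - 1 - node b x.
Proof.
by case: x => m /=; rewrite natrB // -natr1; ring.
Qed.

Lemma node_degreeD n1 n2 (x : 'I_n1 + 'I_n2) :
  (node_degree x + node_degree (node_rev x) + node_codegree x = n1 + n2 - 1)%N.
Proof. by case: x => m /=; have := ltn_ord m; lia. Qed.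

(** The two coefficient matrices are inverse to each other up to diagonal
    factors, the weights being the derivatives of the nodal polynomial. *)
Lemma node_coef_dual (R : numFieldType) n1 n2 (a b : R) (x z : 'I_n1 + 'I_n2)
    (a' := - a - n1%:R - n2%:R) (b' := - b - n1%:R + n2%:R)
    (w := fun t : 'I_n1 + 'I_n2 => (nodal (@node R n1 n2 b))^`().[node b t]) :
  (forall i j, (i < n1)%N -> (j < n1)%N -> i%:R + j%:R + a + b + 1 != 0) ->
  (forall i j, (i < n2)%N -> (j < n2)%N -> i%:R + j%:R + a - b + 1 != 0) ->
  \sum_t node_coef a b x t * node_coef a' b' (node_rev z) (node_rev t) * w t
  = if x == z then node_coef a b x x
                   * node_coef a' b' (node_rev x) (node_rev x) * w x
    else 0.
Proof.
move=> gen1 gen2.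
have root_node (t : 'I_n1 + 'I_n2) : (nodal (@node R n1 n2 b)).[node b t] = 0.
  exact: nodal_root.
have rev_ordE n m : (n - m.+1 = n.-1 - m)%N by lia.
rewrite big_sumType /=; case: x z => i [] j.
- rewrite [X in _ + X]big1 ?addr0 => [|t _]; last by rewrite !mul0r.
  pose v (m : nat) := (nodal (@node R n1 n2 b))^`().[m%:R].
  under eq_bigr => t _ do rewrite /= !rev_ordE -[w _]/(v t).
  rewrite /= !rev_ordE.
  have [[eqij]|neqij] := eqVneq (inl i : 'I_n1 + 'I_n2) (inl j).
    by rewrite -eqij jacobi_coef_pairing_diag.
  apply: jacobi_coef_orthogonal => // [|m ltmn]; first exact: gen1.
  rewrite /v -natr1; apply: nodal_deriv_ratio.
    exact: (root_node (inl (Ordinal (ltnW ltmn)))).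
  by rewrite natr1; exact: (root_node (inl (Ordinal ltmn))).
- by rewrite !big1 ?addr0 // => t _; rewrite ?mulr0 ?mul0r.
- by rewrite !big1 ?addr0 // => t _; rewrite ?mulr0 ?mul0r.
- rewrite [X in X + _]big1 ?add0r => [|t _]; last by rewrite !mul0r.
  pose v (m : nat) := (nodal (@node R n1 n2 b))^`().[m%:R - b].
  under eq_bigr => t _ do rewrite /= !rev_ordE -[w _]/(v t).
  rewrite /= !rev_ordE.
  have [[eqij]|neqij] := eqVneq (inr i : 'I_n1 + 'I_n2) (inr j).
    by rewrite -eqij jacobi_coef_pairing_diag.
  have -> : a' = - a - n2%:R - n1%:R by rewrite /a'; ring.
  have -> : - b' = - - b - n2%:R + n1%:R by rewrite /b'; ring.
  apply: jacobi_coef_orthogonal => // [|m ltmn]; first exact: gen2.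
  have := @nodal_deriv_ratio R n1 n2 b (m%:R - b).
  have mS : m%:R - b + 1 = m.+1%:R - b by rewrite -natr1; ring.
  rewrite mS => /(_ (root_node (inr (Ordinal (ltnW ltmn))))).
  move/(_ (root_node (inr (Ordinal ltmn)))) => E; apply: (eq_of_subr E).
  by rewrite /v -natr1; ring.
Qed.

Definition cat_fun T k l (f : 'I_k -> T) (g : 'I_l -> T) (i : 'I_(k + l)) : T :=
  match split i with inl j => f j | inr j => g j end.

Lemma cat_funl T k l (f : 'I_k -> T) (g : 'I_l -> T) i :
  cat_fun f g (lshift l i) = f i.
Proof. by rewrite /cat_fun -[lshift l i]/(unsplit (inl i)) unsplitK. Qed.

Lemma cat_funr T k l (f : 'I_k -> T) (g : 'I_l -> T) i :
  cat_fun f g (rshift k i) = g i.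
Proof. by rewrite /cat_fun -[rshift k i]/(unsplit (inr i)) unsplitK. Qed.

Lemma cat_fun_inj T k l (f : 'I_k -> T) (g : 'I_l -> T) :
  injective f -> injective g -> (forall i j, f i <> g j) ->
  injective (cat_fun f g).
Proof.
move=> inj_f inj_g fg i j; case: (split_ordP i) => {}i ->;
  case: (split_ordP j) => {}j ->; rewrite ?(cat_funl, cat_funr).
- by move/inj_f->.
- by move/fg.
- by move/esym/fg.
- by move/inj_g->.
Qed.

(** [dual_minors] for the two coefficient matrices, with the rows rho chosen
    for the first one and the reversals of the remaining rows for the
    second one. *)
Lemma reduced_mx_dual (R : numFieldType) n1 n2 k l (a b : R)
    (rho : 'I_k -> 'I_n1 + 'I_n2) (rho' : 'I_l -> 'I_n1 + 'I_n2)
    (a' := - a - n1%:R - n2%:R) (b' := - b - n1%:R + n2%:R) :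
  bijective (cat_fun rho (@node_rev n1 n2 \o rho')) ->
  (forall i j, (i < n1)%N -> (j < n1)%N -> i%:R + j%:R + a + b + 1 != 0) ->
  (forall i j, (i < n2)%N -> (j < n2)%N -> i%:R + j%:R + a - b + 1 != 0) ->
  injective (@node R n1 n2 b) ->
  (forall x : 'I_n1 + 'I_n2, node_coef a b x x != 0) ->
  (forall x : 'I_n1 + 'I_n2, node_coef a' b' x x != 0) ->
  exists2 c : R, c != 0 &
    (1 + 'X) ^+ (2 * n1 * n2 + \sum_(i < n1) i + \sum_(i < n2) i)%N
      * \det (reduced_mx rho a b)
    = c *: ((1 + 'X) ^+ ((n1 + n2 - 1) * k
                         + \sum_(i < l) node_codegree (rho' i))%N
      * \det (reduced_mx rho' a' b')).
Proof.
set u := cat_fun _ _ => bij_u gen1 gen2 inj_node lead lead'.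
have inj_u := bij_inj bij_u.
have cardkl : (k + l = n1 + n2)%N.
  by have := bij_eq_card bij_u; rewrite card_sum !card_ord.
set y : {poly R} := 1 + 'X.
pose w (x : 'I_n1 + 'I_n2) := (nodal (@node R n1 n2 b))^`().[node b x].
have w0 x : w x != 0 by apply: nodal_deriv_neq0.
pose psi := rising 1 (1 - n1%:R : R).
have psiE j (x : 'I_n1 + 'I_n2) : (psi j).[node b x] = pochhammer (- node b' (node_rev x)) j.
  by rewrite horner_rising node_rev_dual; congr (pochhammer _ _); ring.
pose phi := rising (- 1 : R) 0.
have phiE j (x : 'I_n1 + 'I_n2) : (phi j).[node b x] = pochhammer (- node b x) j.
  by rewrite horner_rising; congr (pochhammer _ _); ring.
have sz_psi j : size (psi j) = j.+1 by rewrite size_rising ?oner_eq0.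
have sz_phi j : size (phi j) = j.+1 by rewrite size_rising ?oppr_eq0 ?oner_eq0.
have inj_nu : injective (node b \o u) by exact: inj_comp.
pose C := \matrix_(i, m) node_coef a b (u i) (u m).
pose C' := \matrix_(i, m) node_coef a' b' (node_rev (u i)) (node_rev (u m)).
pose Phi := \matrix_(i < k + l, j < k + l) (phi j).[node b (u i)].
pose Psi := \matrix_(i < k + l, j < l) (psi j).[node b (u i)].
pose Psi' := \matrix_(i < k + l, j < k) (psi (l + j)%N).[node b (u i)].
pose v := \row_i w (u i).
pose dl := \row_i (node_coef a b (u i) (u i)
   * node_coef a' b' (node_rev (u i)) (node_rev (u i)) * w (u i)).
have CvC' : C *m diag_mx v *m C'^T = diag_mx dl.
  apply/matrixP => i j; rewrite !mxE.
  transitivity (\sum_t node_coef a b (u i) t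
     * node_coef a' b' (node_rev (u j)) (node_rev t) * w t).
    rewrite [RHS](reindex u) /=; last exact: onW_bij.
    by apply: eq_bigr => m _; rewrite mul_mx_diag !mxE mulrAC.
  by rewrite node_coef_dual // (inj_eq inj_u); case: eqVneq.
have v0 i : v 0 i != 0 by rewrite mxE.
have dl0 i : dl 0 i != 0 by rewrite mxE !mulf_neq0.
have uPhi : Phi \in unitmx by exact: (poly_basis_unitmx inj_nu).
have uPsi : row_mx Psi' Psi \in unitmx.
  (* Put the columns in increasing order of the degrees. *)
  pose s0 : 'I_(k + l) -> 'I_(k + l) := fun j => cast_ord (addnC l k)
    (match split j with inl i => rshift l i | inr i => lshift k i end).
  have inj_s0 : injective s0.
    move=> i j /cast_ord_inj.
    case: (split_ordP i) => i' ->; case: (split_ordP j) => j' -> /eqP;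
      rewrite ?(eq_lshift, eq_rshift, eq_lrshift, eq_rlshift) //.
      by move/eqP->.
    by move/eqP->.
  have -> : row_mx Psi' Psi = col_perm (perm inj_s0)
      (\matrix_(i < k + l, j < k + l) (psi j).[node b (u i)]).
    apply/matrixP => i j; rewrite !mxE permE /s0.
    by case: split_ordP => i' _; rewrite mxE.
  rewrite col_permE unitmx_mul unitmx_perm andbT.
  exact: (poly_basis_unitmx inj_nu).
have orth : (lsubmx Phi)^T *m diag_mx (map_mx GRing.inv v) *m Psi = 0.
  apply/matrixP => i j; rewrite !mxE.
  transitivity (\sum_x (phi i * psi j).[node b x] / w x).
    rewrite (reindex u) /=; last exact: onW_bij.
    apply: eq_bigr => m _; rewrite mul_mx_diag !mxE hornerM /=.
    by rewrite mulrAC.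
  apply: sum_lagrange_weights => //.
  rewrite card_sum !card_ord -cardkl (leq_ltn_trans (size_polyMleq _ _)) //.
  by rewrite sz_phi sz_psi; have := ltn_ord i; have := ltn_ord j; lia.
have qC i j : C' i j != 0 -> node_codegree (u i) = node_codegree (u j).
  by rewrite mxE; case: (u i) (u j) => ? [] ? //=; rewrite eqxx.
have [c c0] := dual_minors y CvC' v0 dl0 uPhi uPsi orth
   (fun i => node_degreeD (u i)) qC.
have -> : (\sum_i (node_codegree (u i) + node_degree (node_rev (u i)))
    = 2 * n1 * n2 + \sum_(i < n1) i + \sum_(i < n2) i)%N.
  rewrite -(reindex u (P := xpredT) (F := fun x => node_codegree x
     + node_degree (node_rev x))%N) /=; last exact: onW_bij.
  rewrite big_sumType /= !big_split /= !sum_nat_const !card_ord.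
  have revE n : (\sum_(i < n) (n - i.+1) = \sum_(i < n) i)%N.
    by rewrite [RHS](reindex_inj rev_ord_inj).
  rewrite !revE; ring.
set U := usubmx _; set V := dsubmx _.
have -> : U = reduced_mx rho a b.
  apply/matrixP => i j; rewrite !mxE (reindex u) /=; last exact: onW_bij.
  apply: eq_bigr => m _; rewrite mul_mx_diag !mxE [u _]cat_funl.
  by rewrite [val _]/= phiE mulrAC -polyCM mul_polyC.
have -> : V = reduced_mx rho' a' b'.
  apply/matrixP => i j; rewrite !mxE.
  rewrite (reindex (@node_rev n1 n2 \o u)) /=; last first.
    by apply: onW_bij; apply: bij_comp => //; exists (@node_rev n1 n2); apply: node_revK.
  apply: eq_bigr => m _; rewrite mul_mx_diag !mxE [u (rshift _ _)]cat_funr /=.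
  by rewrite node_revK psiE mulrAC -polyCM mul_polyC.
have -> : (\sum_(i < l) node_codegree (u (rshift k i))
    = \sum_(i < l) node_codegree (rho' i))%N.
  by apply: eq_bigr => i _; rewrite [u _]cat_funr /=; case: (rho' i).
by move=> E; exists c.
Qed.

(** * The complementary sets *)

(** One more than the maximum, so that the empty set needs no negative value. *)
Definition fset_bound (F : {fset nat}) : nat :=
  if F == fset0 then 0%N else (\max_(f <- F) f).+1.

Lemma fset_max_bound (F : {fset nat}) : fset_max F = (fset_bound F)%:Z - 1.
Proof.
rewrite /fset_max /fset_bound; case: eqP => _ //.
by rewrite intS addrC addKr.
Qed.

Lemma lt_fset_bound (F : {fset nat}) f : f \in F -> (f < fset_bound F)%N.
Proof.
move=> Ff; rewrite /fset_bound; case: eqP => [F0|_]; first by rewrite F0 in Ff.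
by rewrite ltnS; apply: (leq_bigmax_seq (F := id)).
Qed.

Lemma mem_invol (F : {fset nat}) g :
  (g \in invol F) = (g < fset_bound F)%N && ((fset_bound F).-1 - g \notin F)%N.
Proof.
rewrite /invol /fset_bound; have ltF := @lt_fset_bound F.
case: eqP ltF => [->|_] ltF; first by rewrite inE.
rewrite /fset_bound in ltF.
set m := (\max_(f <- F) f)%N in ltF *.
have memI : (g \in [fset i in iota 0 m.+1]) = (g < m.+1)%N.
  by rewrite in_fset mem_iota add0n.
rewrite in_fsetD memI /= andbC; case: (ltnP g m.+1) => //= ltgm.
congr (~~ _); apply/imfsetP/idP => [[f /= Ff ->]|Fg]; last by exists (m - g)%N => //=; lia.
by rewrite subKn //; have := lt_fset_bound Ff; rewrite /fset_bound; case: eqP => // _.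
Qed.

Lemma fset_bound_invol (F : {fset nat}) :
  (#|` F| + #|` invol F| = fset_bound F)%N.
Proof.
set n := fset_bound F.
pose H := [fset i in iota 0 n].
pose G := [fset (n.-1 - f)%N | f in F].
have cardH : #|` H| = n.
  rewrite card_fseq undup_id ?iota_uniq ?size_iota //.
have memH i : (i \in H) = (i < n)%N by rewrite in_fset mem_iota add0n.
have GE i : (i \in G) = (i < n)%N && (n.-1 - i \in F)%N.
  apply/imfsetP/andP => [[f /= Ff ->]|[ltin Fi]].
    by have := lt_fset_bound Ff; rewrite -/n => ltfn; split; [lia|rewrite subKn //; lia].
  by exists (n.-1 - i)%N => //=; lia.
have cardG : #|` G| = #|` F|.
  apply: card_in_imfset => f f' /= /lt_fset_bound ltf /lt_fset_bound ltf'.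
  by rewrite -/n in ltf ltf' *; lia.
have -> : invol F = H `\` G.
  apply/fsetP => i; rewrite in_fsetD memH GE mem_invol -/n.
  by case: (i < n)%N; rewrite ?andbF ?andbT.
have GH : G `<=` H by apply/fsubsetP => i; rewrite GE memH => /andP[].
by rewrite cardfsDS // cardG cardH subnKC // -cardG -cardH fsubset_leq_card.
Qed.

Lemma fset_nth_mem (F : {fset nat}) i : (i < #|` F|)%N -> fset_nth F i \in F.
Proof.
by move=> lti; rewrite -(mem_sort leq) mem_nth // size_sort.
Qed.

Lemma fset_nth_inj (F : {fset nat}) i j : (i < #|` F|)%N -> (j < #|` F|)%N ->
  fset_nth F i = fset_nth F j -> i = j.
Proof.
move=> lti ltj /eqP; rewrite nth_uniq ?size_sort ?sort_uniq ?fset_uniq //.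
by move/eqP.
Qed.

(** * Polynomial dependence on the parameters *)

Definition poly_fun (R : numFieldType) (f : R -> R) : Prop :=
  exists p : {poly R}, forall t, f t = p.[t].

Lemma poly_fun_cst (R : numFieldType) (c : R) : poly_fun (fun=> c).
Proof. by exists c%:P => t; rewrite hornerC. Qed.

Lemma poly_fun_id (R : numFieldType) : poly_fun (@id R).
Proof. by exists 'X => t; rewrite hornerX. Qed.

Lemma poly_funD (R : numFieldType) (f g : R -> R) :
  poly_fun f -> poly_fun g -> poly_fun (fun t => f t + g t).
Proof.
by move=> [p fE] [q gE]; exists (p + q) => t; rewrite hornerD fE gE.
Qed.

Lemma poly_funM (R : numFieldType) (f g : R -> R) :
  poly_fun f -> poly_fun g -> poly_fun (fun t => f t * g t).
Proof.
by move=> [p fE] [q gE]; exists (p * q) => t; rewrite hornerM fE gE.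
Qed.

Lemma poly_funN (R : numFieldType) (f : R -> R) :
  poly_fun f -> poly_fun (fun t => - f t).
Proof. by move=> [p fE]; exists (- p) => t; rewrite hornerN fE. Qed.

Lemma poly_fun_ext (R : numFieldType) (f g : R -> R) :
  f =1 g -> poly_fun f -> poly_fun g.
Proof. by move=> fg [p fE]; exists p => t; rewrite -fg. Qed.

Lemma poly_fun_sum (R : numFieldType) (I : Type) (r : seq I) (P : pred I)
    (f : I -> R -> R) :
  (forall i, poly_fun (f i)) -> poly_fun (fun t => \sum_(i <- r | P i) f i t).
Proof.
move=> Pf; elim: r => [|i r IHr].
  by apply: poly_fun_ext (poly_fun_cst 0) => t; rewrite big_nil.
case Pi : (P i); last by apply: poly_fun_ext IHr => t; rewrite big_cons Pi.
by apply: poly_fun_ext (poly_funD (Pf i) IHr) => t; rewrite big_cons Pi.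
Qed.

Lemma poly_fun_prod (R : numFieldType) (I : Type) (r : seq I) (P : pred I)
    (f : I -> R -> R) :
  (forall i, poly_fun (f i)) -> poly_fun (fun t => \prod_(i <- r | P i) f i t).
Proof.
move=> Pf; elim: r => [|i r IHr].
  by apply: poly_fun_ext (poly_fun_cst 1) => t; rewrite big_nil.
case Pi : (P i); last by apply: poly_fun_ext IHr => t; rewrite big_cons Pi.
by apply: poly_fun_ext (poly_funM (Pf i) IHr) => t; rewrite big_cons Pi.
Qed.

Lemma poly_fun_pochhammer (R : numFieldType) (f : R -> R) n :
  poly_fun f -> poly_fun (fun t => pochhammer (f t) n).
Proof.
move=> Pf; apply: (poly_fun_prod _ _ (f := fun (i : 'I_n) t => f t + i%:R)).
by move=> i; apply: poly_funD (poly_fun_cst _).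
Qed.

(** A field of characteristic 0 is infinite, so a product of two polynomials
    that vanishes everywhere has a zero factor. *)
Lemma poly_fun_dense (R : numFieldType) (f : R -> R) (g : {poly R}) :
  poly_fun f -> g != 0 -> (forall t, g.[t] != 0 -> f t = 0) -> forall t, f t = 0.
Proof.
move=> [p fE] g0 fg t.
have pg0 : p * g = 0.
  apply: (@roots_geq_poly_eq0 _ _ [seq i%:R | i <- iota 0 (size (p * g))]).
  - apply/allP => _ /mapP[i _ ->]; rewrite rootE hornerM -fE.
    by have [->|/fg->] := eqVneq g.[i%:R] 0; rewrite ?mulr0 ?mul0r.
  - rewrite map_inj_uniq ?iota_uniq // => i j /eqP.
    by rewrite eqr_nat => /eqP.
  - by rewrite size_map size_iota.
by move/eqP: pg0; rewrite mulf_eq0 (negPf g0) orbF fE => /eqP ->; rewrite horner0.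
Qed.

(** Polynomial dependence on a parameter, required of each coefficient
    separately. *)
Definition coef_poly_fun (R : numFieldType) (q : R -> {poly R}) : Prop :=
  forall i, poly_fun (fun t => (q t)`_i).

Lemma coef_poly_fun_cst (R : numFieldType) (p : {poly R}) :
  coef_poly_fun (fun=> p).
Proof. by move=> i; apply: poly_fun_cst. Qed.

Lemma coef_poly_funM (R : numFieldType) (p q : R -> {poly R}) :
  coef_poly_fun p -> coef_poly_fun q -> coef_poly_fun (fun t => p t * q t).
Proof.
move=> Pp Pq i; apply: (poly_fun_ext (fun t => esym (coefM _ _ _))).
by apply: poly_fun_sum => j; apply: poly_funM.
Qed.

Lemma coef_poly_fun_sum (R : numFieldType) (I : Type) (r : seq I) (P : pred I)
    (q : I -> R -> {poly R}) :
  (forall i, coef_poly_fun (q i)) ->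
  coef_poly_fun (fun t => \sum_(i <- r | P i) q i t).
Proof.
move=> Pq i; apply: (poly_fun_ext (fun t => esym (coef_sum _ _ _ _))).
by apply: poly_fun_sum => j; apply: Pq.
Qed.

Lemma coef_poly_funZ (R : numFieldType) (f : R -> R) (q : R -> {poly R}) :
  poly_fun f -> coef_poly_fun q -> coef_poly_fun (fun t => f t *: q t).
Proof.
move=> Pf Pq i; apply: (poly_fun_ext (fun t => esym (coefZ _ _ _))).
exact: poly_funM.
Qed.

Lemma coef_poly_fun_derivn (R : numFieldType) (q : R -> {poly R}) n :
  coef_poly_fun q -> coef_poly_fun (fun t => (q t)^`(n)).
Proof.
move=> Pq i; apply: (poly_fun_ext (fun t => esym (coef_derivn _ _ _))).
apply: (poly_fun_ext (fun t => mulr_natr _ _)).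
by apply: poly_funM (poly_fun_cst _).
Qed.

Lemma coef_poly_fun_prod (R : numFieldType) (I : Type) (r : seq I) (P : pred I)
    (q : I -> R -> {poly R}) :
  (forall i, coef_poly_fun (q i)) ->
  coef_poly_fun (fun t => \prod_(i <- r | P i) q i t).
Proof.
move=> Pq; elim: r => [|i r IHr] j.
  by apply: poly_fun_ext (coef_poly_fun_cst 1 j) => t; rewrite big_nil.
case Pi : (P i); last by apply: poly_fun_ext (IHr j) => t; rewrite big_cons Pi.
apply: poly_fun_ext (coef_poly_funM (Pq i) IHr j) => t.
by rewrite big_cons Pi.
Qed.

Lemma coef_poly_fun_det (R : numFieldType) n (A : R -> 'M[{poly R}]_n) :
  (forall i j, coef_poly_fun (fun t => A t i j)) ->
  coef_poly_fun (fun t => \det (A t)).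
Proof.
move=> PA; apply: coef_poly_fun_sum => s.
apply: coef_poly_funM; first exact: coef_poly_fun_cst.
by apply: coef_poly_fun_prod => i.
Qed.

Lemma coef_poly_fun_jacobi (R : numFieldType) n (a b : R -> R) :
  poly_fun a -> poly_fun b -> coef_poly_fun (fun t => jacobi n (a t) (b t)).
Proof.
move=> Pa Pb; apply: coef_poly_funZ; first exact: poly_fun_cst.
apply: coef_poly_fun_sum => j; apply: coef_poly_funZ (coef_poly_fun_cst _).
by do ![apply: poly_funM|apply: poly_fun_pochhammer|apply: poly_funD
  |exact: poly_fun_cst].
Qed.

Lemma coef_poly_fun_det_quasi_wronskian (R : numFieldType) F (a b : R -> R) :
  poly_fun a -> poly_fun b ->
  coef_poly_fun (fun t => \det (quasi_wronskian_mx F (a t) (b t))).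
Proof.
move=> Pa Pb; apply: coef_poly_fun_det => i j m.
case: (split_ordP i) => i' ->.
  apply: (poly_fun_ext (f := fun t => ((-1) ^+ j
    * (jacobi (fset_nth F.1 i') (a t) (b t))^`(j))`_m)) => [t|].
    by rewrite /quasi_wronskian_mx col_mxEu mxE.
  apply: coef_poly_funM; first exact: coef_poly_fun_cst.
  by apply: coef_poly_fun_derivn; apply: coef_poly_fun_jacobi.
apply: (poly_fun_ext (f := fun t => (pochhammer (b t - (fset_nth F.2 i')%:R) j
  *: ((1 + 'X) ^+ (#|` F.1| + #|` F.2| - 1 - j)
   * jacobi (fset_nth F.2 i') (a t + j%:R) (- b t - j%:R)))`_m)) => [t|].
  by rewrite /quasi_wronskian_mx col_mxEd mxE.
apply: coef_poly_funZ.
  by apply: poly_fun_pochhammer; apply: poly_funD => //; apply: poly_fun_cst.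
apply: coef_poly_funM; first exact: coef_poly_fun_cst.
by apply: coef_poly_fun_jacobi; do ?[exact: poly_fun_cst|exact: Pb|exact: Pa
  |apply: poly_funD|apply: poly_funN].
Qed.

(** * The invariance *)

Lemma double_sum_ord n : (2 * (\sum_(i < n) i) + n = n * n)%N.
Proof.
elim: n => [|n IHn]; first by rewrite big_ord0.
by rewrite big_ord_recr /=; move: (\sum_(i < n) i)%N IHn => s IHn; lia.
Qed.

(** The exponents e and e' do not depend on a and b, and they compensate
    exactly for the different powers of 1 + x by which the two determinants are
    divided in the quasi Wronskians. The hypothesis on a and b excludes an
    integer range large enough for all the Pochhammer symbols, eigenvalues and
    nodes involved. *)
Lemma det_quasi_wronskian_dual (R : numFieldType) (F1 F2 : {fset nat})
    (n1 := fset_bound F1) (n2 := fset_bound F2) (N := (2 * (n1 + n2) + 2)%N) :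
  exists e e', (e + #|` F2| * (#|` F2| - 1)
                = e' + #|` invol F2| * (#|` invol F2| - 1))%N /\
  forall a b : R,
    (forall i j, (i < N)%N -> (j < N)%N ->
      [/\ b + i%:R - j%:R != 0, a + b + i%:R - j%:R != 0
        & a - b + i%:R - j%:R != 0]) ->
    exists2 c : R, c != 0 &
      (1 + 'X) ^+ e * \det (quasi_wronskian_mx (F1, F2) a b)
      = c *: ((1 + 'X) ^+ e' * \det (quasi_wronskian_mx (invol F1, invol F2)
                (- a - n1%:R - n2%:R) (- b - n1%:R + n2%:R))).
Proof.
set k1 := #|` F1|; set k2 := #|` F2|.
set l1 := #|` invol F1|; set l2 := #|` invol F2|.
have kl1 : (k1 + l1 = n1)%N by exact: fset_bound_invol.
have kl2 : (k2 + l2 = n2)%N by exact: fset_bound_invol.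
pose A := (2 * n1 * n2 + \sum_(i < n1) i + \sum_(i < n2) i)%N.
pose A' := ((n1 + n2 - 1) * (k1 + k2) + (l1 * n2 + l2 * n1))%N.
exists (l2 * (l1 + l2 - 1) + A + \sum_(j < k1 + k2) j)%N.
exists (k2 * (k1 + k2 - 1) + A' + \sum_(j < l1 + l2) j)%N; split.
  have Sk := double_sum_ord (k1 + k2); have Sl := double_sum_ord (l1 + l2).
  have S1 := double_sum_ord n1; have S2 := double_sum_ord n2.
  (* The truncated m - 1 is harmless, as p = 0 when m = 0. *)
  have pred_mul m p : (p <= m)%N -> (p * (m - 1) + p = p * m)%N.
    by case: m => [|m]; rewrite ?subn1 /=; [case: p | rewrite mulnS addnC].
  have Ek2 := pred_mul (k1 + k2)%N k2 (leq_addl _ _).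
  have El2 := pred_mul (l1 + l2)%N l2 (leq_addl _ _).
  have Ek := pred_mul k2 k2 (leqnn _); have El := pred_mul l2 l2 (leqnn _).
  have EN : ((k1 + k2) * (n1 + n2 - 1) + (k1 + k2) = (k1 + k2) * (n1 + n2))%N.
    by apply: pred_mul; lia.
  rewrite /A /A'; rewrite -kl1 -kl2 in S1 S2 EN *.
  move: (\sum_(i < k1 + k2) i)%N (\sum_(i < l1 + l2) i)%N
    (\sum_(i < k1 + l1) i)%N (\sum_(i < k2 + l2) i)%N Sk Sl S1 S2 => Sk Sl S1 S2.
  lia.
move=> a b gen; set a' := - a - _ - _; set b' := - b - _ + _.
have ltF (F : {fset nat}) (i : 'I_#|` F|) : (fset_nth F i < fset_bound F)%N.
  by apply: lt_fset_bound; apply: fset_nth_mem.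
have ltG (F : {fset nat}) (i : 'I_#|` invol F|) :
    (fset_nth (invol F) i < fset_bound F)%N.
  by have := fset_nth_mem (ltn_ord i); rewrite mem_invol => /andP[].
have [r rE] : exists r : forall F : {fset nat}, 'I_#|` F| -> 'I_(fset_bound F),
    forall F i, r F i = fset_nth F i :> nat by exists (fun F i => Ordinal (ltF F i)).
have [s sE] : exists s : forall F, 'I_#|` invol F| -> 'I_(fset_bound F),
    forall F i, s F i = fset_nth (invol F) i :> nat.
  by exists (fun F i => Ordinal (ltG F i)).
pose rho : 'I_(k1 + k2) -> 'I_n1 + 'I_n2 :=
  cat_fun (fun i => inl (r F1 i)) (fun i => inr (r F2 i)).
pose rho' : 'I_(l1 + l2) -> 'I_n1 + 'I_n2 :=
  cat_fun (fun i => inl (s F1 i)) (fun i => inr (s F2 i)).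
have r_inj F : injective (r F).
  move=> i j /(congr1 val); rewrite /= !rE => /fset_nth_inj ij.
  by apply/val_inj/ij.
have s_inj F : injective (s F).
  move=> i j /(congr1 val); rewrite /= !sE => /fset_nth_inj ij.
  by apply/val_inj/ij.
(* By definition I(F) reverses the complement of F. *)
have rs F i j : r F i <> rev_ord (s F j).
  move/(congr1 val); rewrite /= rE sE => rsE.
  have := fset_nth_mem (ltn_ord j); rewrite mem_invol => /andP[lt_s].
  have -> : ((fset_bound F).-1 - fset_nth (invol F) j = fset_nth F i)%N.
    by rewrite rsE -subn1 -subnDA add1n.
  by rewrite fset_nth_mem.
have bij_u : bijective (cat_fun rho (@node_rev n1 n2 \o rho')).
  apply: inj_card_bij; last by rewrite card_sum !card_ord; lia.
  apply: cat_fun_inj => [||i j].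
  - by apply: cat_fun_inj => // i j => [[/r_inj]|[/r_inj]].
  - apply: inj_comp (can_inj (@node_revK n1 n2)) _.
    by apply: cat_fun_inj => // i j => [[/s_inj]|[/s_inj]].
  rewrite /rho /rho'; case: (split_ordP i) => {}i ->;
    case: (split_ordP j) => {}j ->; rewrite /= ?(cat_funl, cat_funr) //=.
    by case=> /rs.
  by case=> /rs.
have gen_ab m p : (m < N)%N -> (p < N)%N -> a + b + m%:R - p%:R != 0.
  by move=> ltm ltp; case: (gen m p ltm ltp).
have gen_amb m p : (m < N)%N -> (p < N)%N -> a - b + m%:R - p%:R != 0.
  by move=> ltm ltp; case: (gen m p ltm ltp).
have gen_b m p : (m < N)%N -> (p < N)%N -> b + m%:R - p%:R != 0.
  by move=> ltm ltp; case: (gen m p ltm ltp).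
have poch0 (x : R) n : (forall i, (i < n)%N -> x + i%:R != 0) -> pochhammer x n != 0.
  by move=> x0; apply/prodf_neq0 => i _; apply: x0.
have [c c0 EG] : exists2 c : R, c != 0 &
    (1 + 'X) ^+ (2 * n1 * n2 + \sum_(i < n1) i + \sum_(i < n2) i)%N
      * \det (reduced_mx rho a b)
    = c *: ((1 + 'X) ^+ ((n1 + n2 - 1) * (k1 + k2)
                         + \sum_(i < l1 + l2) node_codegree (rho' i))%N
      * \det (reduced_mx rho' a' b')).
  apply: reduced_mx_dual => //.
  - move=> i j lti ltj; have := gen_ab (i + j + 1)%N 0%N.
    rewrite !natrD subr0 => gen'.
    have -> : i%:R + j%:R + a + b + 1 = a + b + (i%:R + j%:R + 1) :> R by ring.
    by apply: gen'; rewrite /N; lia.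
  - move=> i j lti ltj; have := gen_amb (i + j + 1)%N 0%N.
    rewrite !natrD subr0 => gen'.
    have -> : i%:R + j%:R + a - b + 1 = a - b + (i%:R + j%:R + 1) :> R by ring.
    by apply: gen'; rewrite /N; lia.
  - case=> i [] j /= /eqP.
    + by rewrite eqr_nat => /eqP ij; congr inl; apply/val_inj.
    + move=> /eqP ij; have := @gen_b i j; rewrite ij.
      have -> : b + (j%:R - b) - j%:R = 0 :> R by ring.
      have := ltn_ord i; have := ltn_ord j; rewrite eqxx /N => ltj lti H.
      by suff: ~~ true by []; apply: H; lia.
    + move=> /eqP ij; have := @gen_b j i; rewrite -ij.
      have -> : b + (i%:R - b) - i%:R = 0 :> R by ring.
      have := ltn_ord i; have := ltn_ord j; rewrite eqxx /N => ltj lti H.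
      by suff: ~~ true by []; apply: H; lia.
    + by move/eqP/addIr/eqP; rewrite eqr_nat => /eqP ij; congr inr; apply/val_inj.
  - case=> m; apply: jacobi_coef_lead_neq0; apply: poch0 => i lti;
      have ltm := ltn_ord m.
    + have := gen_ab (m + 1 + i)%N 0%N; rewrite !natrD subr0 => gen'.
      have -> : m%:R + a + b + 1 + i%:R = a + b + (m%:R + 1 + i%:R) :> R by ring.
      by apply: gen'; rewrite /N; lia.
    + have := gen_amb (m + 1 + i)%N 0%N; rewrite !natrD subr0 => gen'.
      have -> : m%:R + a - b + 1 + i%:R = a - b + (m%:R + 1 + i%:R) :> R by ring.
      by apply: gen'; rewrite /N; lia.
  - case=> m; apply: jacobi_coef_lead_neq0; apply: poch0 => i lti;
      have ltm := ltn_ord m; rewrite /a' /b' -oppr_eq0.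
    + have := gen_ab (2 * n1)%N (m + 1 + i)%N; rewrite natrM !natrD => gen'.
      set z := - _.
      have -> : z = a + b + 2 * n1%:R - (m%:R + 1 + i%:R) :> R by rewrite /z; ring.
      by apply: gen'; rewrite /N; lia.
    + have := gen_amb (2 * n2)%N (m + 1 + i)%N; rewrite natrM !natrD => gen'.
      set z := - _.
      have -> : z = a - b + 2 * n2%:R - (m%:R + 1 + i%:R) :> R by rewrite /z; ring.
      by apply: gen'; rewrite /N; lia.
have EF := @quasi_wronskian_mx_reduced R (F1, F2) n1 n2 a b (r F1) (r F2) rho
  (rE F1) (rE F2) (cat_funl _ _) (cat_funr _ _).
have EF' := @quasi_wronskian_mx_reduced R (invol F1, invol F2) n1 n2 a' b'
  (s F1) (s F2) rho' (sE F1) (sE F2) (cat_funl _ _) (cat_funr _ _).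
rewrite /= -/k1 -/k2 in EF; rewrite /= -/l1 -/l2 in EF'.
have codegE : (\sum_(i < l1 + l2) node_codegree (rho' i) = l1 * n2 + l2 * n1)%N.
  rewrite big_split_ord /=; congr (_ + _)%N.
    rewrite (eq_bigr (fun=> n2)) ?sum_nat_const ?card_ord // => i _.
    by rewrite [rho' _]cat_funl.
  rewrite (eq_bigr (fun=> n1)) ?sum_nat_const ?card_ord // => i _.
  by rewrite [rho' _]cat_funr.
rewrite codegE -/A -/A' in EG; exists c => //.
move: A A' EG => A A' EG; rewrite !exprD -!mulrA.
set red := \det _ in EG EF; set red' := \det (reduced_mx rho' a' b') in EG EF'.
set D := \det _ in EF *; set D' := \det _ in EF' *.
set y : {poly R} := 1 + 'X in EF EF' EG *.
rewrite EF' EF [y ^+ A * _]mulrCA EG.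
by rewrite -!scalerAr; congr (_ *: _); ring.
Qed.

(** Multiplying dividend and divisor by the same power does not change the
    Euclidean quotient, so the quotients agree even if they are not exact. *)
Lemma divp_pow_eq (F : fieldType) (y p q : {poly F}) (e d e' d' : nat) :
  y != 0 -> (e + d = e' + d')%N -> y ^+ e * p = y ^+ e' * q ->
  p %/ y ^+ d = q %/ y ^+ d'.
Proof.
move=> y0 ed pq.
rewrite -(divp_pmul2l (d := y ^+ e)) ?expf_neq0 // -exprD pq ed exprD.
by rewrite divp_pmul2l ?expf_neq0.
Qed.

Lemma proportional_of_coef_cross (F : fieldType) (p q : {poly F}) :
  p != 0 -> q != 0 -> (forall i j, p`_i * q`_j = p`_j * q`_i) ->
  exists2 c : F, c != 0 & p = c *: q.
Proof.
move=> p0 q0 pq; set j := (size q).-1.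
have qj : q`_j != 0 by rewrite -lead_coefE lead_coef_eq0.
have pE : p = (p`_j / q`_j) *: q.
  by apply/polyP => i; rewrite coefZ mulrAC -pq mulfK.
exists (p`_j / q`_j) => //; apply: contra_neq p0 => c0.
by rewrite pE c0 scale0r.
Qed.

Theorem theorem8p1 (R : numFieldType) (F : {fset nat} * {fset nat})
    (alpha beta alpha' beta' : R)
    (halpha : alpha' = - alpha - (fset_max F.1)%:~R - (fset_max F.2)%:~R - 2)
    (hbeta : beta' = - beta - (fset_max F.1)%:~R + (fset_max F.2)%:~R)
    (hu : lead_coef (quasi_wronskian F alpha beta) != 0)
    (hu' : lead_coef (quasi_wronskian (invol_pair F) alpha' beta') != 0) :
  normalized_quasi_wronskian F alpha beta
  = normalized_quasi_wronskian (invol_pair F) alpha' beta'.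
Proof.
case: F halpha hbeta hu hu' => F1 F2; rewrite /invol_pair /= !fset_max_bound.
set n1 := fset_bound F1; set n2 := fset_bound F2 => halpha hbeta hu hu'.
have {}halpha : alpha' = - alpha - n1%:R - n2%:R.
  by rewrite halpha !rmorphB /= -!pmulrn; ring.
have {}hbeta : beta' = - beta - n1%:R + n2%:R.
  by rewrite hbeta !rmorphB /= -!pmulrn; ring.
(* Along this line each of b, a + b and a - b varies with t. *)
pose a (t : R) := alpha + 3 * t; pose b (t : R) := beta + t.
pose D t := \det (quasi_wronskian_mx (F1, F2) (a t) (b t)).
pose D' t := \det (quasi_wronskian_mx (invol F1, invol F2)
  (- a t - n1%:R - n2%:R) (- b t - n1%:R + n2%:R)).
pose N := (2 * (n1 + n2) + 2)%N.
pose g := \prod_(i < N) \prod_(j < N)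
  ((1 *: 'X + (beta + i%:R - j%:R)%:P)
  * (4 *: 'X + (alpha + beta + i%:R - j%:R)%:P)
  * (2 *: 'X + (alpha - beta + i%:R - j%:R)%:P)) : {poly R}.
have g0 : g != 0.
  have linear_neq0 (c d : R) : c != 0 -> c *: 'X + d%:P != 0.
    move=> c0; rewrite -size_poly_eq0 size_polyDl size_scale ?size_polyX //.
    by rewrite ltnS (leq_trans (size_polyC_leq1 _)).
  apply/prodf_neq0 => i _; apply/prodf_neq0 => j _.
  by rewrite !mulf_neq0 ?linear_neq0 ?oner_neq0 ?pnatr_eq0.
have linE (c d t : R) : (c *: 'X + d%:P).[t] = c * t + d.
  by rewrite hornerD hornerZ hornerX hornerC.
have [e [e' [ee' dual]]] := det_quasi_wronskian_dual R F1 F2.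
have generic_dual t : g.[t] != 0 -> exists2 c : R, c != 0 &
    (1 + 'X) ^+ e * D t = c *: ((1 + 'X) ^+ e' * D' t).
  move=> gt; apply: dual => i j lti ltj.
  move: gt; rewrite horner_prod => /prodf_neq0 /(_ (Ordinal lti) isT).
  rewrite horner_prod => /prodf_neq0 /(_ (Ordinal ltj) isT) /=.
  rewrite !hornerM !linE !mulf_eq0 !negb_or => /andP[/andP[Hb Hab] Hamb].
  split.
  - have -> // : b t + i%:R - j%:R = 1 * t + (beta + i%:R - j%:R).
    by rewrite /b; ring.
  - have -> // : a t + b t + i%:R - j%:R
      = 4 * t + (alpha + beta + i%:R - j%:R) by rewrite /a /b; ring.
  - have -> // : a t - b t + i%:R - j%:R
      = 2 * t + (alpha - beta + i%:R - j%:R) by rewrite /a /b; ring.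
have Pb : poly_fun b by apply: poly_funD (poly_fun_cst _) (poly_fun_id _).
have Pa : poly_fun a.
  by apply: poly_funD (poly_fun_cst _) (poly_funM (poly_fun_cst _) (poly_fun_id _)).
have PD : coef_poly_fun (fun t => (1 + 'X) ^+ e * D t).
  apply: coef_poly_funM; first exact: coef_poly_fun_cst.
  exact: coef_poly_fun_det_quasi_wronskian.
have PD' : coef_poly_fun (fun t => (1 + 'X) ^+ e' * D' t).
  apply: coef_poly_funM; first exact: coef_poly_fun_cst.
  by apply: coef_poly_fun_det_quasi_wronskian;
    do ![exact: poly_fun_cst|exact: Pa|exact: Pb|apply: poly_funD|apply: poly_funN].
have cross i j t : ((1 + 'X) ^+ e * D t)`_i * ((1 + 'X) ^+ e' * D' t)`_j
    - ((1 + 'X) ^+ e * D t)`_j * ((1 + 'X) ^+ e' * D' t)`_i = 0.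
  move: t; apply: (poly_fun_dense _ g0) => [|t /generic_dual[c _ ->]].
    by apply: poly_funD; [|apply: poly_funN]; apply: poly_funM.
  by rewrite !coefZ; ring.
have D0E : D 0 = \det (quasi_wronskian_mx (F1, F2) alpha beta).
  by rewrite /D /a /b mulr0 !addr0.
have D'0E : D' 0 = \det (quasi_wronskian_mx (invol F1, invol F2) alpha' beta').
  by rewrite /D' /a /b mulr0 !addr0 -halpha -hbeta.
have y0 : (1 + 'X : {poly R}) != 0.
  by rewrite addrC -size_poly_eq0 -[1]opprK -polyCN size_XsubC.
have D0 : D 0 != 0.
  apply: contraNneq hu => D_0; rewrite /quasi_wronskian -D0E D_0 div0p.
  by rewrite lead_coef0.
have D'0 : D' 0 != 0.
  apply: contraNneq hu' => D_0; rewrite /quasi_wronskian -D'0E D_0 div0p.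
  by rewrite lead_coef0.
have [||i j|c c0 DD'] := @proportional_of_coef_cross _ ((1 + 'X) ^+ e * D 0)
  ((1 + 'X) ^+ e' * D' 0).
- by rewrite mulf_neq0 ?expf_neq0.
- by rewrite mulf_neq0 ?expf_neq0.
- by apply/eqP; rewrite -subr_eq0 cross.
have UU' : quasi_wronskian (F1, F2) alpha beta
    = c *: quasi_wronskian (invol F1, invol F2) alpha' beta'.
  rewrite /quasi_wronskian -D0E -D'0E -divpZl.
  by apply: divp_pow_eq y0 ee' _; rewrite -scalerAr.
rewrite /normalized_quasi_wronskian UU' lead_coefZ scalerA invfM mulrAC.
by rewrite mulVf ?mul1r.
Qed.
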